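(* Every signed graph $G$ with maximum average degree $\mathrm{mad}(G) < \frac{20}{7}$ admits a homomorphism to the signed Paley graph $SP_5$. That is, $\chi_s(\mathcal{M}_{\frac{20}{7}}) \le 5$.
   Context: A signed graph $G=(V,E,s)$ is a finite simple graph $(V,E)$ (no loops, no parallel edges) together with a signature $s:E\to\{-1,+1\}$; edges with sign $+1$ are positive, with sign $-1$ negative. Switching a vertex $v$ reverses the sign of every edge incident to $v$; two signed graphs are switching equivalent if one can be obtained from the other by a sequence of switches. For signed graphs $G$ and $H$, a map $\varphi:V(G)\to V(H)$ is a homomorphism if there is a signed graph $G'$ switching equivalent to $G$ such that for every edge $uv$ of $G'$, $\varphi(u)\varphi(v)$ is an edge of $H$ with the same sign as $uv$ in $G'$. The chromatic number $\chi_s(G)$ is the minimum order of a signed graph $H$ such that $G$ admits a homomorphism to $H$; for a class $\mathcal{C}$ of signed graphs, $\chi_s(\mathcal{C})$ is the maximum of $\chi_s(G)$ over $G\in\mathcal{C}$. The maximum average degree $\mathrm{mad}(G)$ is the maximum of $2|E(H)|/|V(H)|$ over all (nonempty) subgraphs $H$ of the underlying graph; $\mathcal{M}_k$ denotes the class of signed graphs with $\mathrm{mad} < k$. For a prime power $q\equiv 1 \pmod 4$, the signed Paley graph $SP_q$ has vertex set the finite field $\mathbb{F}_q$, and any two distinct vertices $u,v$ are joined by a positive edge if $u-v$ is a square in $\mathbb{F}_q$ and by a negative edge otherwise (so $SP_q$ is a complete signed graph on $q$ vertices). *)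

(* Defs.v *)
From Stdlib Require Import Relations.
From mathcomp Require Import all_boot all_order all_algebra.
Set Implicit Arguments. Unset Strict Implicit. Unset Printing Implicit Defensive.
Import GRing.Theory Num.Theory.

(* A signed graph on a finite vertex type T is given by an adjacency relation
   e : rel T (simple: symmetric and irreflexive) and a signature
   s : T -> T -> bool, where for an edge uv, s u v = true means the edge is
   NEGATIVE and s u v = false means POSITIVE (only values on edges matter). *)
Definition signed_graph (T : finType) (e : rel T) (s : T -> T -> bool) : Prop :=
  symmetric e /\ irreflexive e /\ (forall u v, e u v -> s u v = s v u).

Definition switch (T : finType) (w : T) (s : T -> T -> bool) : T -> T -> bool :=
  fun u v => s u v (+) ((u == w) (+) (v == w)).

Definition switch_equiv (T : finType) (s s' : T -> T -> bool) : Prop :=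
  clos_refl_trans (T -> T -> bool) (fun a b => exists w, b = switch w a) s s'.

Definition signed_hom (T U : finType) (e : rel T) (s : T -> T -> bool)
    (e' : rel U) (s' : U -> U -> bool) (phi : T -> U) : Prop :=
  exists s2, switch_equiv s s2 /\
    forall u v, e u v -> e' (phi u) (phi v) /\ s' (phi u) (phi v) = s2 u v.

Definition n_edges_in (T : finType) (e : rel T) (S : {set T}) : nat :=
  #|[set p : T * T | [&& p.1 \in S, p.2 \in S & e p.1 p.2]]| %/ 2.

(* mad(G) < k : every nonempty subgraph H has 2|E(H)|/|V(H)| < k.
   It suffices (and is equivalent) to range over induced subgraphs. *)
Definition mad_lt (T : finType) (e : rel T) (k : rat) : Prop :=
  forall S : {set T}, S != set0 ->
    ((2 * n_edges_in e S)%:R / (#|S|)%:R < k)%R.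

Definition paley_adj (F : finFieldType) : rel F := fun u v => u != v.
Definition paley_neg (F : finFieldType) (u v : F) : bool :=
  ~~ [exists x : F, (x ^+ 2 == u - v)%R].

(* Main.v *)
Require Import Defs.
From Stdlib Require Import Relations.
From mathcomp Require Import all_boot all_order all_algebra.
From mathcomp Require Import zify.

(** Vertices are coloured in the antipodal double cover of SP_5, ten colours
    (vertex of SP_5, switching bit), so that switching becomes part of the
    colouring.  An edge whose other end is coloured leaves 4 of the 10 colours.
    Call a vertex a leaf if it has degree 3 and exactly one neighbour of degree
    2, and weak if it has degree 3, no neighbour of degree 2 and two leaf
    neighbours.  Uncoloured, a neighbour of degree 2 forbids at most 1 colour,
    a leaf (with its neighbour of degree 2) at most 2, two leaves at most 5, and
    a weak vertex (with its leaves) at most 1.  In a minimal counterexample it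
    follows that a vertex of degree 3 (resp. 4) has at most 1 (resp. 2)
    neighbours of degree 2, that leaves are pairwise nonadjacent, that no vertex
    has three leaves as its only neighbours, and that a vertex of degree 3
    without neighbours of degree 2 is not adjacent to a leaf and a weak vertex,
    nor to two weak vertices.
    Let each vertex of degree at least 3 send 3/7 to its neighbours of degree 2,
    1/7 to its leaf neighbours and, unless it is a leaf, 1/7 to its weak
    neighbours: every vertex ends with at least 20/7, contradicting mad < 20/7. *)

Set Implicit Arguments. Unset Strict Implicit. Unset Printing Implicit Defensive.

Import GRing.Theory Num.Theory Order.TTheory.

(** * Colours *)

Notation color := ('I_5 * bool)%type.

(** Subtraction is truncated, so [k] is the distance between [i] and [j] as natural numbers; 2 and 3
    are the nonsquares modulo 5, a set closed under negation. *)
Definition nonsquare (i j : 'I_5) : bool :=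
  let k := (i - j) + (j - i) in (k == 2) || (k == 3).

(* An edge of sign [a] (with [true] negative) is respected once its ends have
   the colours [c] and [d], the second components telling which ends are
   switched. *)
Definition compat (a : bool) (c d : color) : bool :=
  (c.1 != d.1) && (a (+) (c.2 (+) d.2) == nonsquare c.1 d.1).

Definition flip (a : bool) (c : color) : color := (c.1, a (+) c.2).

(** An explicit list, so that the exhaustive checks below reduce under [vm_compute]. *)
Definition colors : seq color :=
  [seq (i, b) | i <- [:: @Ordinal 5 0 isT; @Ordinal 5 1 isT; @Ordinal 5 2 isT;
                         @Ordinal 5 3 isT; @Ordinal 5 4 isT],
                b <- [:: true; false]].

Definition compatible d := [seq c <- colors | compat false c d].

Lemma mem_colors c : c \in colors.
Proof. by case: c => [[[|[|[|[|[|i]]]]] // lti] []]. Qed.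

Lemma all_colors P : all P colors -> forall c, P c.
Proof. by move=> /allP P_colors c; apply/P_colors/mem_colors. Qed.

Lemma all_signs P : all P [:: true; false] -> forall b, P b.
Proof. by case/and3P=> Pt Pf _ []. Qed.

Lemma has_colorsP (P : pred color) : reflect (exists c, P c) (has P colors).
Proof.
apply: (iffP hasP) => [[c _ Pc]|[c Pc]]; exists c => //; exact: mem_colors.
Qed.

Lemma mem_compatible c d : (c \in compatible d) = compat false c d.
Proof. by rewrite mem_filter mem_colors andbT. Qed.

Lemma count_compatible P d :
  count P (compatible d) = count (fun c => compat false c d && P c) colors.
Proof. by rewrite count_filter; apply: eq_count => c /=; rewrite andbC. Qed.

Lemma has_compatible P d :
  has P (compatible d) = has (fun c => compat false c d && P c) colors.
Proof. by rewrite !has_count count_compatible. Qed.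

Lemma flipK a : involutive (flip a).
Proof. by case=> c b; rewrite /flip /= addbA addbb. Qed.

Lemma flip_flip a b c : flip a (flip b c) = flip (a (+) b) c.
Proof. by rewrite /flip /= addbA. Qed.

Lemma perm_flip a : perm_eq [seq flip a c | c <- colors] colors.
Proof. by case: a; vm_compute. Qed.

Lemma count_flip a p : count (fun c => p (flip a c)) colors = count p colors.
Proof. by rewrite -(count_map (flip a)); apply/permP/perm_flip. Qed.

(** Flipping the bit of an end absorbs the sign of an edge, so that the exhaustive checks can take
    most edges to be positive. *)
Lemma compat_flipr a b c d : compat a c (flip b d) = compat (a (+) b) c d.
Proof. by rewrite /compat /flip /= [c.2 (+) _]addbCA !addbA. Qed.

Lemma compat_flipl a b c d : compat a (flip b c) d = compat (a (+) b) c d.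
Proof. by rewrite /compat /flip /= !addbA. Qed.

Lemma compatC a c d : compat a c d = compat a d c.
Proof.
rewrite /compat eq_sym [c.2 (+) _]addbC; congr (_ && (_ == _)).
by rewrite /nonsquare addnC.
Qed.

Lemma compat_neq a b c d : compat a c d -> c != flip b d.
Proof. by case/andP=> /eqP ne _; apply/eqP => eq_c; apply: ne; rewrite eq_c. Qed.

(** * Numbers of compatible and of forbidden colours *)

Lemma count_eq_color q : count (pred1 q) colors = 1.
Proof. by apply/eqP; move: q; apply: all_colors; vm_compute. Qed.

Lemma count_compat a y : count (fun c => compat a c y) colors = 4.
Proof.
transitivity (count (fun c => compat false c (flip a y)) colors).
  by apply: eq_count => c /=; rewrite compat_flipr.
by apply/eqP; move: (flip a y); apply: all_colors; vm_compute.
Qed.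

Lemma ex_compat a y : exists c, compat a c y.
Proof. by apply/has_colorsP; rewrite has_count count_compat. Qed.

(** Most reductions use this pigeonhole: the colours allowed to a vertex outnumber those forbidden
    by the uncoloured pieces hanging from it. *)
Lemma pick_color (a p : pred color) :
  count p colors < count a colors -> exists2 c, a c & ~~ p c.
Proof.
move=> lt_pa; case: (boolP (has (predD a p) colors)) => [/has_colorsP[c /andP[]]|].
  by exists c.
rewrite -all_predC => /all_colors sub_ap; move: lt_pa; rewrite ltnNge sub_count //.
by move=> c ac; move: (sub_ap c); rewrite /= ac andbT negbK.
Qed.

Lemma count_or (p q : pred color) m n :
  count p colors <= m -> count q colors <= n ->
  count (fun c => p c || q c) colors <= m + n.
Proof.
move=> le_m le_n; apply: leq_trans (leq_add le_m le_n).
by rewrite -count_predUI leq_addr.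
Qed.

(** Two colours lack a common compatible colour only if they are antipodal, up to the signs of the
    two edges. Hence an uncoloured vertex of degree 2 forbids at most one colour. *)
Lemma path2_compat a b c d :
  c != flip (~~ (a (+) b)) d -> exists x, compat a x c && compat b x d.
Proof.
have: all (fun c => all (fun d => (c != flip true d) ==>
  has (fun x => compat false x c && compat false x d) colors) colors) colors.
  by vm_compute.
move/all_colors/(_ (flip a c))/all_colors/(_ (flip b d))/implyP=> link ne.
have /link/has_colorsP[x]: flip a c != flip true (flip b d).
  apply: contra ne => /eqP eq_c.
  by rewrite -(flipK a c) eq_c !flip_flip; case: (a); case: (b).
by rewrite !compat_flipr; exists x.
Qed.

(** Bans of a leaf coloured [d]: [y] leaves four values for [d], the neighbour of degree 2 removes
    at most [q], and the neighbourhoods of the remaining ones miss at most two colours. *)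
Lemma path3_compat a b y q :
  count (fun c => ~~ has (fun d => [&& compat a d c, compat b d y & d != q]) colors)
    colors <= 2.
Proof.
have: all (fun y => all (fun q =>
    let A := [seq d <- compatible y | d != q] in
    count (fun c => ~~ has (compat false c) A) colors <= 2) colors) colors.
  by vm_compute.
move/all_colors/(_ (flip b y))/all_colors/(_ q); apply: leq_trans.
rewrite -(count_flip a) sub_count // => c; apply: contra => /hasP[d].
rewrite mem_filter mem_compatible => /andP[dq dy] cd; apply/has_colorsP; exists d.
by rewrite dq compat_flipr addbb compatC cd; move: dy; rewrite compat_flipr => ->.
Qed.

(* Two distinct neighbourhoods of colours cover at least five colours. *)
Lemma four_bans (p : pred color) k :
  count p colors <= 4 ->
  count (fun z => ~~ has (fun c => compat k c z && ~~ p c) colors) colors <= 1.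
Proof.
move=> p4; rewrite leqNgt; apply/negP => lt1.
set B := (fun z => _) in lt1.
have [z1 Bz1 _] : exists2 z, B z & ~~ pred0 z.
  by apply: pick_color; rewrite count_pred0 (leq_trans _ lt1).
have [z2 Bz2 nz] : exists2 z, B z & ~~ pred1 z1 z.
  by apply: pick_color; rewrite count_eq_color.
have: all (fun z1 => all (fun z2 => (z1 != z2) ==>
   (4 < count (fun c => compat false c z1 || compat false c z2) colors)) colors) colors.
  by vm_compute.
move/all_colors/(_ (flip k z1))/all_colors/(_ (flip k z2))/implyP.
rewrite (inj_eq (inv_inj (flipK k))) eq_sym => /(_ nz).
apply/negP; rewrite -leqNgt (leq_trans _ p4) // sub_count // => c.
rewrite !compat_flipr /= => /orP[] cz.
  by apply: contraR Bz1 => npc; apply/has_colorsP; exists c; rewrite cz.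
by apply: contraR Bz2 => npc; apply/has_colorsP; exists c; rewrite cz.
Qed.

(* [c] leaves colours [d], [d'] to two leaves sharing their neighbour of degree 2
   (whence [d' != flip k d]), with last neighbours coloured [y1] and [y2]. *)
Definition shared_path k y1 y2 c :=
  has (fun d => compat false c d &&
    has (fun d' => d' != flip k d) [seq d' <- compatible y2 | compat false c d'])
  (compatible y1).

Lemma shared_path_bans a1 b1 a2 b2 k y1 y2 : exists p : pred color,
  [/\ count p colors <= 5,
      forall k', count (fun z => ~~ has (fun c => compat k' c z && ~~ p c) colors)
                   colors <= 1 &
      forall c, ~~ p c -> exists d1 d2,
        [/\ compat a1 d1 c, compat b1 d1 y1, compat a2 d2 c, compat b2 d2 y2 &
            d2 != flip k d1]].
Proof.
have: all (fun k => all (fun y1 => all (fun y2 =>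
    let A := [seq c <- colors | ~~ shared_path k y1 y2 c] in
    (size A <= 5) && (count (fun z => all (mem A) (compatible z)) colors <= 1))
    colors) colors) [:: true; false].
  by vm_compute.
(* The colours sought are [flip a1 d] and [flip a2 d'], which makes both edges to [c] positive and
   moves the remaining signs to [k], [y1] and [y2]. *)
move/all_signs/(_ (a2 (+) (k (+) a1)))/all_colors/(_ (flip (b1 (+) a1) y1)).
move/all_colors/(_ (flip (b2 (+) a2) y2)).
set q := shared_path _ _ _; set A := [seq c <- colors | _] => /andP[A5 A1].
exists (predC q); split=> [|k'|c].
- by rewrite -size_filter.
- apply: leq_trans A1; rewrite -[X in _ <= X](count_flip k') sub_count // => z.
  move=> /hasPn noc; apply/allP => c; rewrite mem_compatible => cz.
  rewrite compat_flipr in cz; rewrite inE mem_filter mem_colors andbT.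
  by move: (noc c (mem_colors c)); rewrite cz negbK.
rewrite /= negbK => /hasP[d]; rewrite mem_compatible compat_flipr => dy1.
case/andP=> cd /hasP[d']; rewrite mem_filter mem_compatible compat_flipr.
case/andP=> cd' d'y2 dd'; exists (flip a1 d), (flip a2 d').
rewrite !compat_flipl !addbb ![compat false _ c]compatC; split=> //.
apply: contra dd' => /eqP eq_d; apply/eqP.
by rewrite -(flipK a2 d') eq_d !flip_flip addbA.
Qed.

Lemma half_good y :
  count (fun c => 2 <= count (compat false c) (compatible y)) colors = 5.
Proof. by apply/eqP; move: y; apply: all_colors; vm_compute. Qed.

(** Two values of [z] survive the single ban of a branch hanging from [z], and five values of [c]
    exceed the four bans of two leaves. *)
Lemma good_compat a b y :
  count (fun c => 1 < count (fun z => compat a z y && compat b z c) colors) colors = 5.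
Proof.
rewrite -[RHS](half_good (flip a y)) -[RHS](count_flip b).
apply: eq_count => c; rewrite count_compatible; congr (_ < _); apply: eq_count => z.
by rewrite compat_flipr compat_flipl [compat _ c z]compatC addbC addbF.
Qed.

Lemma good_compat_near a b g y y' :
  exists2 c, compat g c y' & 1 < count (fun z => compat a z y && compat b z c) colors.
Proof.
have: all (fun y => all (fun y' => has (fun c =>
   2 <= count (compat false c) (compatible y)) (compatible y')) colors) colors.
  by vm_compute.
move/all_colors/(_ (flip a y))/all_colors/(_ (flip (b (+) g) y')).
rewrite has_compatible => /has_colorsP[c /andP[cy' cy]]; exists (flip b c).
  by move: cy'; rewrite compat_flipr compat_flipl /= addbC.
apply: leq_trans cy _; rewrite count_compatible sub_count // => z.
by rewrite !compat_flipr addbb compatC [compat _ c z]compatC.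
Qed.

(** For a triangle [u], [z], [v] with [z] also joined to [y]: two values of [u] survive one ban by a
    vertex of degree 2, and three values of [v] survive the two bans of a leaf. *)
Lemma triangle_compat a b g h y :
  2 < count (fun v => has (fun z => [&& compat a z y, compat b z v &
        1 < count (fun u => compat g u z && compat h u v) colors]) colors) colors.
Proof.
have: all (fun h => all (fun y => 2 < count (fun v =>
    has (fun z => compat false v z && (2 <= count (compat h v) (compatible z)))
      (compatible y)) colors) colors) [:: true; false].
  by vm_compute.
move/all_signs/(_ (b (+) (g (+) h)))/all_colors/(_ (flip a y)).
rewrite -[X in _ < X -> _](count_flip b) => /leq_trans-> //; apply: sub_count => v.
rewrite has_compatible => /has_colorsP[z /and3P[zy vz uz]]; apply/has_colorsP; exists z.
rewrite compat_flipr in zy; rewrite compat_flipl compatC in vz; rewrite zy vz.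
apply: leq_trans uz _; rewrite count_compatible -[X in _ <= X](count_flip g).
apply: sub_count => u; rewrite !compat_flipl addbb [compat _ _ u]compatC => /andP[->].
by rewrite addbAC addbb [h (+) g]addbC.
Qed.

(** For two triangles with the common edge [x z] and apexes [u1], [u2]: two values of [u2] survive
    one ban by a vertex of degree 2. *)
Lemma two_triangles_compat a b g h k u1 :
  1 < count (fun u2 => has (fun z => [&& compat a z u1, compat b z u2 &
    has (fun x => [&& compat g x u1, compat h x u2 & compat k x z]) colors]) colors)
    colors.
Proof.
have: all (fun h => all (fun k => all (fun u1 => 1 < count (fun u2 =>
   has (fun z => compat false z u2 &&
     has (fun x => compat h x u2 && compat k x z) (compatible u1)) (compatible u1))
    colors) colors) [:: true; false]) [:: true; false].
  by vm_compute.
move/all_signs/(_ (h (+) g (+) (b (+) a)))/all_signs/(_ (k (+) g (+) a)).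
move/all_colors/(_ u1); rewrite -[X in _ < X -> _](count_flip (b (+) a)).
move/leq_trans; apply; apply: sub_count => u2.
rewrite has_compatible => /has_colorsP[z /and3P[zu1 zu2]].
rewrite has_compatible => /has_colorsP[x /and3P[xu1 xu2 xz]].
rewrite !compat_flipr in zu2 xu2.
apply/has_colorsP; exists (flip a z); rewrite !compat_flipl addbb zu1 zu2 !andTb.
apply/has_colorsP; exists (flip g x); rewrite !compat_flipl !compat_flipr addbb xu1 xz.
by rewrite addbK in xu2; rewrite xu2.
Qed.

(** * Reducible configurations *)

Section Configurations.

Variables (T : finType) (e : rel T) (s : T -> T -> bool).
Hypotheses (e_sym : symmetric e) (e_irr : irreflexive e).
Hypothesis s_sym : forall u v, e u v -> s u v = s v u.

Implicit Types (X Y D : {set T}) (f g : {ffun T -> color}) (u v w x y z : T).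

(** * Extending a colouring to a set of vertices *)

Definition upd f v c : {ffun T -> color} := [ffun x => if x == v then c else f x].

(* [f] can be recoloured on [X] so that every edge leaving a vertex of [X] is
   satisfied, except those towards the deferred vertices [D]. *)
Definition ext X D f : bool :=
  [exists g : {ffun T -> color}, [forall x, (x \notin X) ==> (g x == f x)] &&
    [forall x in X, forall n, e x n && (n \notin D) ==> compat (s x n) (g x) (g n)]].

Lemma extP X D f : reflect
  (exists g, (forall x, x \notin X -> g x = f x) /\
     (forall x n, x \in X -> e x n -> n \notin D -> compat (s x n) (g x) (g n)))
  (ext X D f).
Proof.
apply: (iffP existsP) => -[g].
  case/andP=> /forallP gf /forallP gX; exists g; split=> [x xX|x n xX xn nD].
    by apply/eqP; move: (gf x); rewrite xX.
  by move: (gX x); rewrite xX => /forallP/(_ n); rewrite xn nD.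
case=> gf gX; exists g; apply/andP; split; apply/forallP => x.
  by apply/implyP => /gf->.
apply/implyP => xX; apply/forallP => n; apply/implyP => /andP[]; exact: gX.
Qed.

Lemma updE f v c x : upd f v c x = if x == v then c else f x.
Proof. by rewrite ffunE. Qed.

Lemma upd_same f v c : upd f v c v = c.
Proof. by rewrite updE eqxx. Qed.

Lemma upd_other f v c x : x != v -> upd f v c x = f x.
Proof. by rewrite updE => /negbTE->. Qed.

Lemma compat_edge u v c d : e u v -> compat (s u v) c d = compat (s v u) d c.
Proof. by move=> uv; rewrite (s_sym uv) compatC. Qed.

Lemma edge_neq u v : e u v -> u != v.
Proof. by apply: contraTneq => ->; rewrite e_irr. Qed.

Lemma disjoint_set0 X : [disjoint X & set0].
Proof. by rewrite -setI_eq0 setI0. Qed.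

Lemma disjoint_setD X D : [disjoint X :\: D & D].
Proof.
rewrite -setI_eq0; apply/eqP/setP => x; rewrite in_setI in_setD in_set0.
by case: (x \in D); rewrite ?andbF.
Qed.

Lemma ext0 D f : ext set0 D f.
Proof. by apply/extP; exists f; split=> // x n; rewrite inE. Qed.

(** Colouring in two rounds: edges between [X] and [Y] are checked only in the second round, from
    the side of [Y]. *)
Lemma ext_seq X Y D f g :
  [disjoint X & Y] -> [disjoint X & D] ->
  (forall x, x \notin X -> g x = f x) ->
  (forall x n, x \in X -> e x n -> n \notin Y -> n \notin D ->
     compat (s x n) (g x) (g n)) ->
  ext Y D g -> ext (X :|: Y) D f.
Proof.
move=> XY XD gf gX /extP[h [hg hY]]; apply/extP; exists h; split=> [x|x n].
  by rewrite inE negb_or => /andP[xX xY]; rewrite hg ?gf.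
rewrite inE => /orP[xX|xY] xn nD; last exact: hY.
have xY : x \notin Y by rewrite (disjointFr XY xX).
case: (boolP (n \in Y)) => nY; last by rewrite !hg //; apply: gX.
rewrite compat_edge // hY // 1?e_sym //.
by rewrite (disjointFr XD xX).
Qed.

Lemma ext_add v Y D f c :
  v \notin Y -> v \notin D ->
  (forall n, e v n -> n \notin Y -> n \notin D -> compat (s v n) c (f n)) ->
  ext Y D (upd f v c) -> ext (v |: Y) D f.
Proof.
move=> vY vD vn; apply: ext_seq; rewrite ?disjoints1 //.
  by move=> x; rewrite inE => /upd_other->.
move=> x n; rewrite inE => /eqP-> xn nY nD.
by rewrite upd_same upd_other ?vn // eq_sym edge_neq.
Qed.

Lemma ext1 v D f c :
  v \notin D -> (forall n, e v n -> n \notin D -> compat (s v n) c (f n)) ->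
  ext [set v] D f.
Proof.
move=> vD vn; rewrite -[[set v]]setU0; apply: ext_add; rewrite ?inE ?ext0 //.
by move=> n xn _; apply: vn.
Qed.

Lemma ext_congr X D f f' :
  (forall x n, x \in X -> e x n -> n \notin X -> n \notin D -> f n = f' n) ->
  ext X D f -> ext X D f'.
Proof.
move=> ff' /extP[g [gf gX]]; apply/extP.
exists [ffun x => if x \in X then g x else f' x]; split=> [x|x n] xX.
  by rewrite ffunE (negbTE xX).
move=> xn nD; rewrite !ffunE xX; case: ifPn => nX; first exact: gX.
by rewrite -(ff' x n) // -gf //; apply: gX.
Qed.

Definition separate X Y := forall x y, x \in X -> y \in Y -> (x != y) && ~~ e x y.

Lemma separateC X Y : separate X Y -> separate Y X.
Proof. by move=> sXY x y xY yX; rewrite eq_sym e_sym sXY. Qed.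

Lemma separateU X Y Z : separate X Z -> separate Y Z -> separate (X :|: Y) Z.
Proof. by move=> sX sY x y /setUP[] xX yZ; [apply: sX | apply: sY]. Qed.

(** Pieces that neither meet nor touch are extended independently, which is why their bans add
    up. *)
Lemma ext_union X Y D f :
  separate X Y -> [disjoint X & D] -> ext X D f -> ext Y D f -> ext (X :|: Y) D f.
Proof.
move=> sXY XD /extP[g [gf gX]] eY; apply: (@ext_seq X Y D f g) => //.
- rewrite -setI_eq0; apply/eqP/setP => x; rewrite !inE; apply/negP => /andP[xX xY].
  by move: (sXY x x xX xY); rewrite eqxx.
- by move=> x n xX xn _ nD; apply: gX.
apply: ext_congr eY => x n xY xn nY nD; rewrite gf //; apply/negP => nX.
by move: (sXY n x nX xY); rewrite e_sym xn andbF.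
Qed.

Definition bans X D v f : pred color := fun c => ~~ ext X D (upd f v c).

(** What minimality provides: the graph without [X] has a colouring, and that one does not extend.
    Quantifying over arbitrary [f] is harmless, since [ext] constrains only edges meeting [X]. *)
Hypothesis irreducible : forall X, X != set0 -> ~ (forall f, ext X set0 f).

(** * Degrees and vertices of degree 2 *)

Definition nb v := [set n | e v n].
Definition deg v := #|nb v|.
Definition two v := deg v == 2.
Definition twos v := [set n in nb v | two n].
(* [t31] are the leaves of the header, [t30] the vertices of degree 3 without
   neighbours of degree 2; [wof u] is the neighbour of degree 2 of a leaf [u]. *)
Definition t31 v := (deg v == 3) && (#|twos v| == 1).
Definition t30 v := (deg v == 3) && (#|twos v| == 0).
Definition weak v := t30 v && (1 < #|[set n in nb v | t31 n]|).

Lemma deg_gt1 v : 1 < deg v.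
Proof.
rewrite ltnNge; apply/negP => /card_le1_eqP nb1.
apply: (@irreducible [set v]); first by apply/set0Pn; exists v; rewrite inE.
move=> f; case: (pickP (e v)) => [y vy|nov].
  have [c cy] := ex_compat (s v y) (f y).
  apply: (@ext1 _ _ _ c); rewrite ?inE // => n vn _.
  by have -> : n = y by apply: nb1; rewrite inE.
by apply: (@ext1 _ _ _ (f v)); rewrite ?inE // => n; rewrite nov.
Qed.

Lemma two_nbrs w u : two w -> e w u ->
  exists t, [/\ t != u, e w t & forall n, e w n = (n == u) || (n == t)].
Proof.
move=> /eqP w2 wu; have: #|nb w :\ u| == 1.
  by move: w2; rewrite /deg (cardsD1 u) inE wu add1n => -[->].
case/cards1P=> t /setP Et; have:= Et t; rewrite !inE eqxx => /andP[tu wt].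
exists t; split=> // n; have:= Et n; rewrite !inE => <-.
by case: eqVneq => // ->.
Qed.

Lemma three_nbrs v a b : deg v = 3 -> e v a -> e v b -> a != b ->
  exists c, [/\ c != a, c != b, e v c &
                forall n, e v n = [|| n == a, n == b | n == c]].
Proof.
move=> v3 va vb ab; have: #|nb v :\ a :\ b| == 1.
  move: v3; rewrite /deg (cardsD1 a) inE va (cardsD1 b) !inE vb eq_sym ab !add1n.
  by case=> ->.
case/cards1P=> c /setP Ec; have:= Ec c; rewrite !inE eqxx => /and3P[cb ca vc].
exists c; split=> // n; have:= Ec n; rewrite !inE => <-.
by case: (eqVneq n a) => [->|] //=; case: (eqVneq n b) => [->|].
Qed.

(** Deferring an end drops its constraint, and a single coloured neighbour always leaves a colour;
    otherwise [path2_compat] applies. *)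
Lemma two_ext w u t D f : w \notin D ->
  (forall n, e w n = (n == u) || (n == t)) ->
  (u \notin D -> t \notin D ->
   f u != flip (~~ (s w u (+) s w t)) (f t)) -> ext [set w] D f.
Proof.
move=> wD wn; case: (boolP (u \in D)) => uD ne.
  have [c cy] := ex_compat (s w t) (f t); apply: (@ext1 _ _ _ c) => // n.
  by rewrite wn => /orP[] /eqP-> //; rewrite uD.
case: (boolP (t \in D)) ne => tD ne.
  have [c cy] := ex_compat (s w u) (f u); apply: (@ext1 _ _ _ c) => // n.
  by rewrite wn => /orP[] /eqP-> //; rewrite tD.
have [c /andP[cu ct]] := path2_compat (ne isT isT).
by apply: (@ext1 _ _ _ c) => // n; rewrite wn => /orP[] /eqP->.
Qed.

Lemma two_bans w v D f : two w -> e w v -> w \notin D ->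
  count (bans [set w] D v f) colors <= 1.
Proof.
move=> w2 wv wD; have [t [tv wt wn]] := two_nbrs w2 wv.
rewrite -[X in _ <= X](count_eq_color (flip (~~ (s w v (+) s w t)) (f t))).
apply: sub_count => c; rewrite /bans; apply: contraR => /= ne.
by apply: (two_ext wD wn) => _ _; rewrite upd_same upd_other.
Qed.

(** If they were adjacent, the other neighbour of [w'] would leave it four colours, of which [w]
    bans at most one. *)
Lemma two_two w w' : two w -> two w' -> ~~ e w w'.
Proof.
move=> w2 w'2; apply/negP => ww'; have w'w: e w' w by rewrite e_sym.
have [t [tw w't wn]] := two_nbrs w'2 w'w.
apply: (@irreducible [set w'; w]); first by apply/set0Pn; exists w; rewrite !inE eqxx orbT.
move=> f; have [|c ct /negPn cw] :=
  @pick_color (fun c => compat (s w' t) c (f t)) (bans [set w] set0 w' f).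
  by rewrite count_compat; apply: leq_ltn_trans (two_bans _ _ _ _) _; rewrite ?inE.
apply: (@ext_add _ _ _ _ c) => //; rewrite ?inE ?(edge_neq w'w) // => n.
by rewrite wn !inE => /orP[] /eqP-> //; rewrite eqxx.
Qed.


Lemma star_bans v ws f : uniq ws -> (forall w, w \in ws -> e v w && two w) ->
  count (bans [set w in ws] set0 v f) colors <= size ws.
Proof.
elim: ws => [_ _|w ws IH].
  rewrite (@eq_count _ _ pred0) ?count_pred0 // => c.
  by rewrite /bans set_nil ext0.
rewrite cons_uniq => /andP[w_ws uws] ws2.
have/andP[vw w2] : e v w && two w by apply: ws2; rewrite inE eqxx.
have {}IH : count (bans [set w in ws] set0 v f) colors <= size ws.
  by apply: IH => // w' w'_ws; apply: ws2; rewrite inE w'_ws orbT.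
rewrite -[size _]/(1 + size ws).
apply: leq_trans (count_or (two_bans (v := v) (D := set0) f w2 _ _) IH).
- apply: sub_count => c; rewrite /bans set_cons; apply: contraR.
  rewrite negb_or !negbK => /andP[ew ews]; apply: ext_union ew ews.
    move=> x y; rewrite !inE => /eqP-> y_ws; apply/andP; split.
      by apply: contra w_ws => /eqP->.
    by apply: two_two => //; have/ws2/andP[] : y \in w :: ws by rewrite inE y_ws orbT.
  by rewrite disjoint_set0.
- by rewrite e_sym.
- by rewrite inE.
Qed.

(** Otherwise all neighbours of [v] but one, [y], can be taken of degree 2: [y] leaves four colours
    to [v], and the others ban at most three. *)
Lemma twos_bound v : deg v <= 4 -> #|twos v| + 2 <= deg v.
Proof.
move=> v4; rewrite leqNgt; apply/negP => lt2.
have v2 := deg_gt1 v.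
(* Exactly [deg v - 1] neighbours are taken even if all have degree 2; the one left over then counts
   as coloured. *)
set k := (deg v).-1; have lek : k <= size (enum (twos v)).
  by rewrite -cardE /k; move: lt2; rewrite addn2 -subn1 leq_subLR add1n ltnS.
pose ws := take k (enum (twos v)).
have uws : uniq ws by rewrite take_uniq ?enum_uniq.
have sws : size ws = k by rewrite size_takel.
have ws2 w : w \in ws -> e v w && two w.
  by move/mem_take; rewrite mem_enum !inE.
have: #|nb v :\: [set w in ws]| == 1.
  rewrite cardsD (setIidPr _); last first.
    by apply/subsetP => w; rewrite !inE => /ws2/andP[].
  have -> : #|[set w in ws]| = k by rewrite cardsE (card_uniqP uws).
  rewrite -/(deg v) /k.
  by case: (deg v) v2 => // n _; rewrite /= subSnn.
case/cards1P=> y /setP Ey.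
apply: (@irreducible (v |: [set w in ws])).
  by apply/set0Pn; exists v; rewrite !inE eqxx.
move=> f; have [|c cy /negPn cw] := @pick_color (fun c => compat (s v y) c (f y))
   (bans [set w in ws] set0 v f).
  rewrite count_compat; apply: leq_ltn_trans (star_bans _ uws ws2) _.
  by rewrite sws /k; case: (deg v) v4 v2.
apply: (@ext_add _ _ _ _ c) => //; rewrite ?inE //.
  by apply/negP => /ws2; rewrite e_irr.
move=> n vn nws _; have := Ey n; rewrite !inE vn.
by move: nws; rewrite inE => -> /esym/eqP->.
Qed.

(** * Leaves with their neighbours of degree 2 *)

Definition wof u := odflt u [pick n in twos u].
Definition leaf u := [set u; wof u].

Lemma t31_deg u : t31 u -> deg u = 3.
Proof. by case/andP=> /eqP. Qed.

Lemma t30_deg u : t30 u -> deg u = 3.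
Proof. by case/andP=> /eqP. Qed.

Lemma t31_two u : t31 u -> ~~ two u.
Proof. by rewrite /two => /t31_deg->. Qed.

Lemma t30_two u : t30 u -> ~~ two u.
Proof. by rewrite /two => /t30_deg->. Qed.

Lemma t30_nbr u n : t30 u -> e u n -> ~~ two n.
Proof.
case/andP=> _; rewrite cards_eq0 => /eqP/setP/(_ n); rewrite !inE => nn un.
by move: nn; rewrite un => /= ->.
Qed.

Lemma t30_t31 u : t30 u -> ~~ t31 u.
Proof. by rewrite /t30 /t31 => /andP[_ /eqP->]; rewrite andbF. Qed.

Lemma weak_t30 v : weak v -> t30 v.
Proof. by case/andP. Qed.

Lemma wofP u : t31 u ->
  [/\ e u (wof u), two (wof u) & forall n, e u n -> two n -> n = wof u].
Proof.
case/andP=> _ /cards1P[w Ew]; rewrite /wof.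
case: pickP => [n|/(_ w)]; last by rewrite Ew inE eqxx.
have Ewn n' : e u n' && two n' = (n' == w) by rewrite -in_set1 -Ew !inE.
rewrite !inE Ewn => /eqP->; have := Ewn w; rewrite eqxx => /andP[uw w2].
by split=> // n' un' n'2; apply/eqP; rewrite -Ewn un'.
Qed.

Lemma leaf_nbrs u v : t31 u -> e u v -> ~~ two v ->
  exists y t, [/\ y != v, e u y, forall n, e u n = [|| n == v, n == wof u | n == y],
    t != u & forall n, e (wof u) n = (n == u) || (n == t)].
Proof.
move=> u31 uv v2; have [uw w2 _] := wofP u31.
have vw : v != wof u by apply: contraNneq v2 => ->.
have [y [yv yw uy un]] := three_nbrs (t31_deg u31) uv uw vw.
have wu : e (wof u) u by rewrite e_sym.
by have [t [tu wt wn]] := two_nbrs w2 wu; exists y, t.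
Qed.

Lemma notin_leaf u v : t31 u -> e u v -> ~~ two v -> v \notin leaf u.
Proof.
move=> ut uv v2; rewrite !inE negb_or eq_sym edge_neq //=.
by apply: contraNneq v2 => ->; have [] := wofP ut.
Qed.

Lemma set1D w D : [set w] :\: D = if w \in D then set0 else [set w].
Proof.
by case: ifP => wD; apply/setP => x; rewrite !inE; case: eqVneq => [->|]; rewrite ?wD ?andbF.
Qed.

Lemma leaf_bans D v u f : t31 u -> e u v -> ~~ two v ->
  count (bans (leaf u :\: D) D v f) colors <= 2.
Proof.
move=> u31 uv v2; have [y [t [yv uy un tu wn]]] := leaf_nbrs u31 uv v2.
have [uw w2 _] := wofP u31.
set q := flip (~~ (s (wof u) u (+) s (wof u) t)) (f t).
apply: leq_trans (path3_compat (s u v) (s u y) (f y) q).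
apply: sub_count => c; rewrite /bans; apply: contraR => /negPn/has_colorsP.
case=> d /and3P[dc dy dq]; rewrite /leaf setDUl !set1D.
case: (boolP (u \in D)) => uD.
  rewrite set0U; case: (boolP (wof u \in D)) => wD; first exact: ext0.
  by apply: (two_ext wD wn); rewrite uD.
apply: (@ext_add _ _ _ _ d) => //.
- case: ifP => _; rewrite !inE //; exact: edge_neq.
- move=> n; rewrite un => /or3P[] /eqP-> nw nD.
  + by rewrite upd_same.
  + by move: nw; rewrite (negbTE nD) inE eqxx.
  + by rewrite upd_other.
case: (boolP (wof u \in D)) => wD; first exact: ext0.
apply: (two_ext wD wn) => _ _; rewrite upd_same (upd_other _ _ tu) updE.
(* If [wof u] closes a triangle with [u] and [v], its other neighbour has colour [c]; being
   compatible with [d], it cannot be the forbidden antipode. *)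
by case: (eqVneq t v) => _ //; apply: compat_neq dc.
Qed.

(** The third neighbour [y] of [u'] leaves it four colours, against one ban by [wof u'] and two by
    the leaf [u]. *)
Lemma t31_t31 u u' : t31 u -> t31 u' -> ~~ e u u'.
Proof.
move=> u31 u'31; apply/negP => uu'.
have u'u: e u' u by rewrite e_sym.
have [y [t [yv uy un tu wn]]] := leaf_nbrs u'31 u'u (t31_two u31).
have [u'w' w'2 _] := wofP u'31; have [uw w2 uw1] := wofP u31.
(* Empty when both leaves share their neighbour of degree 2, which [leaf u] then contains. *)
pose W := [set wof u'] :\: leaf u.
apply: (@irreducible (u' |: (W :|: leaf u))).
  by apply/set0Pn; exists u'; rewrite !inE eqxx.
move=> f; have [|c cy] := @pick_color (fun c => compat (s u' y) c (f y))
   (fun c => bans W set0 u' f c || bans (leaf u) set0 u' f c).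
  rewrite count_compat; apply: leq_ltn_trans (count_or (m := 1) (n := 2) _ _) _ => //.
    rewrite /W set1D; case: ifP => _.
      by rewrite (@eq_count _ _ pred0) ?count_pred0 // => c; rewrite /bans ext0.
    by apply: two_bans; rewrite ?inE 1?e_sym.
  by have := @leaf_bans set0 u' u f u31 uu' (t31_two u'31); rewrite setD0.
rewrite negb_or !negbK => /andP[cW cL].
have u'L : u' \notin leaf u.
  rewrite !inE negb_or (edge_neq u'u) /=.
  by apply: contraTneq w2 => <-; apply: t31_two.
have w'u' : u' != wof u' by apply: edge_neq.
have u'W : u' \notin W :|: leaf u.
  by rewrite in_setU negb_or u'L andbT in_setD in_set1 negb_and w'u' orbT.
apply: (@ext_add _ _ _ _ c) => //; first by rewrite inE.
  move=> n; rewrite un => /or3P[] /eqP-> //.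
    by rewrite !inE eqxx /= ?orbT.
  by rewrite /W !inE eqxx andbT orNb.
apply: ext_union => //; last by rewrite disjoint_set0.
move=> a b; rewrite !inE negb_or => /andP[/andP[w'u w'w] /eqP Ea].
rewrite Ea in w'u w'w *; case/orP=> /eqP->.
  rewrite w'u /=; apply: contra w'w; rewrite e_sym => uw'.
  by apply/eqP/uw1.
by rewrite w'w two_two.
Qed.

(** Two leaves can only interact through a shared neighbour of degree 2, and this one is
    deferred. *)
Lemma leaf_separate D u1 u2 : t31 u1 -> t31 u2 -> u1 != u2 ->
  (wof u1 = wof u2 -> wof u1 \in D) -> separate (leaf u1 :\: D) (leaf u2 :\: D).
Proof.
move=> u1t u2t u12 ww x y.
have [_ w1 u1w] := wofP u1t; have [_ w2 u2w] := wofP u2t.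
rewrite !inE => /andP[xD /orP[] /eqP Ex] /andP[yD /orP[] /eqP Ey]; subst x y.
- by rewrite u12 t31_t31.
- apply/andP; split; first by apply: contraNneq (t31_two u1t) => ->.
  by apply: contra yD => uw; rewrite (u1w _ uw w2); apply/ww/esym/u1w.
- apply/andP; split; first by apply: contraNneq (t31_two u2t) => <-.
  by apply: contra xD; rewrite e_sym => uw; apply/ww/u2w.
- apply/andP; split; last exact: two_two.
  by apply: contra xD => /eqP/ww.
Qed.


Lemma leaf_separate0 u1 u2 : t31 u1 -> t31 u2 -> u1 != u2 -> wof u1 != wof u2 ->
  separate (leaf u1) (leaf u2).
Proof.
move=> u1t u2t u12 /eqP w12; rewrite -[leaf u1]setD0 -[leaf u2]setD0.
by apply: leaf_separate => // /w12.
Qed.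

Lemma leaf_bans0 v u f : t31 u -> e u v -> ~~ two v ->
  count (bans (leaf u) set0 v f) colors <= 2.
Proof. by rewrite -[leaf u]setD0; apply: leaf_bans. Qed.

(** With distinct neighbours of degree 2 the bans add up to four and [four_bans] applies; with a
    common one, [shared_path_bans] does. *)
Lemma leaves_bans v u1 u2 f :
  t31 u1 -> t31 u2 -> u1 != u2 -> e u1 v -> e u2 v -> ~~ two v ->
  exists p : pred color, [/\ count p colors <= 5,
    forall k, count (fun d => ~~ has (fun c => compat k c d && ~~ p c) colors) colors
                <= 1 &
    forall c, ~~ p c -> ext (leaf u1 :|: leaf u2) set0 (upd f v c)].
Proof.
move=> u1t u2t u12 u1v u2v v2; case: (eqVneq (wof u1) (wof u2)) => [ww|ww]; last first.
  pose p c := bans (leaf u1) set0 v f c || bans (leaf u2) set0 v f c.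
  have p4 : count p colors <= 4 by apply: (count_or (m := 2) (n := 2)); apply: leaf_bans0.
  exists p; split=> [|k|c]; [exact: leq_trans p4 _ | exact: four_bans|].
  rewrite negb_or !negbK => /andP[]; apply: ext_union; first exact: leaf_separate0.
  exact: disjoint_set0.
have [y1 [t1 [y1v uy1 un1 _ _]]] := leaf_nbrs u1t u1v v2.
have [y2 [t2 [y2v uy2 un2 _ _]]] := leaf_nbrs u2t u2v v2.
have [uw1 w2 _] := wofP u1t; have [uw2 _ _] := wofP u2t; rewrite -ww in uw2 un2.
have wu2 : e (wof u1) u2 by rewrite e_sym.
have [t [_ _ wn]] := two_nbrs w2 wu2.
have {wn} wn n : e (wof u1) n = (n == u2) || (n == u1).
  by have := wn u1; rewrite e_sym uw1 (negbTE u12) wn => /esym/eqP <-.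
(* The sign for which the common neighbour can be coloured unless [u2] has the colour of [u1]
   flipped by [k]. *)
pose k := ~~ (s (wof u1) u2 (+) s (wof u1) u1).
have [p [p5 p1 pc]] :=
  shared_path_bans (s u1 v) (s u1 y1) (s u2 v) (s u2 y2) k (f y1) (f y2).
exists p; split=> // c /pc[d1 [d2 [d1c d1y d2c d2y d12]]].
have -> : leaf u1 :|: leaf u2 = u1 |: (u2 |: [set wof u1]).
  by rewrite /leaf -ww setUACA setUid -setUA.
have y1u2 : y1 != u2 by apply: contraTneq uy1 => ->; apply: t31_t31.
have y2u1 : y2 != u1 by apply: contraTneq uy2 => ->; apply: t31_t31; rewrite ?e_sym.
apply: (@ext_add _ _ _ _ d1); rewrite ?in_set0 //.
- by rewrite !inE negb_or u12 edge_neq.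
- move=> n; rewrite un1 => /or3P[] /eqP-> nY _.
  + by rewrite upd_same.
  + by rewrite !inE eqxx orbT in nY.
  + by rewrite upd_other.
apply: (@ext_add _ _ _ _ d2); rewrite ?in_set0 //.
- by rewrite !inE edge_neq.
- move=> n; rewrite un2 => /or3P[] /eqP-> nY _.
  + by rewrite upd_other ?upd_same // edge_neq // e_sym.
  + by rewrite !inE eqxx in nY.
  + by rewrite !upd_other.
apply: (two_ext _ wn); rewrite ?in_set0 // => _ _.
by rewrite upd_same upd_other // upd_same.
Qed.

(** * Weak vertices with their leaves, and triples of leaves *)

Definition branch v u1 u2 := v |: (leaf u1 :|: leaf u2).

(** A colour of [z] is banned only if the two leaves ban all colours of [v] compatible with it,
    which [leaves_bans] allows for at most one colour. *)
Lemma branch_bans v u1 u2 z f :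
  t31 u1 -> t31 u2 -> u1 != u2 -> t30 v -> t30 z ->
  (forall n, e v n = [|| n == u1, n == u2 | n == z]) -> ~~ e z u1 -> ~~ e z u2 ->
  count (bans (branch v u1 u2) set0 z f) colors <= 1.
Proof.
move=> u1t u2t u12 v3 z3 vn zu1 zu2.
have u1v : e u1 v by rewrite e_sym vn eqxx.
have u2v : e u2 v by rewrite e_sym vn eqxx orbT.
have v2 := t30_two v3.
have [p [_ p1 pc]] := leaves_bans f u1t u2t u12 u1v u2v v2.
apply: leq_trans (p1 (s v z)); apply: sub_count => d; rewrite /bans.
apply: contraR => /negPn/has_colorsP[c /andP[cd /pc ec]].
have zl u x : t31 u -> ~~ e z u -> x \in leaf u -> ~~ e x z.
  move=> ut zu; rewrite !inE => /orP[] /eqP->; rewrite e_sym //.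
  by have [_ w2 _] := wofP ut; apply: contraL w2; apply: t30_nbr.
apply: (@ext_add _ _ _ _ c); rewrite ?in_set0 //.
- by rewrite in_setU negb_or !notin_leaf.
- move=> n; rewrite vn => /or3P[] /eqP-> nY _.
  + by rewrite !inE eqxx in nY.
  + by rewrite !inE eqxx orbT in nY.
  + by rewrite upd_same.
(* No vertex of the two leaves is adjacent to [z], so recolouring [z] does not affect them. *)
apply: ext_congr ec => x n xL xn nL _; rewrite !updE; case: (n == v) => //.
case: eqVneq xn => // ->; case/setUP: xL => /zl; first by move=> /(_ u1t zu1)/negPf->.
by move=> /(_ u2t zu2)/negPf->.
Qed.

Lemma wof_triple u1 u2 u3 : t31 u1 -> t31 u2 -> t31 u3 -> u1 != u2 -> u1 != u3 ->
  wof u1 = wof u2 -> wof u1 = wof u3 -> u2 = u3.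
Proof.
move=> u1t u2t u3t u12 u13 w12 w13.
have [uw1 w2 _] := wofP u1t; have [uw2 _ _] := wofP u2t; have [uw3 _ _] := wofP u3t.
rewrite -w12 e_sym in uw2; rewrite -w13 e_sym in uw3; rewrite e_sym in uw1.
have [t [_ _ wn]] := two_nbrs w2 uw1.
move: uw2 uw3; rewrite !wn ![_ == u1]eq_sym (negbTE u12) (negbTE u13).
by move=> /eqP-> /eqP->.
Qed.

Lemma count_colors : count predT colors = 10.
Proof. by rewrite count_predT. Qed.

(** All ten colours are open to [z]; the pair [u1], [u2] bans at most five and [u3], separate from
    them, at most two. *)
Lemma three_leaves_distinct z u1 u2 u3 : t31 u1 -> t31 u2 -> t31 u3 ->
  u1 != u2 -> u1 != u3 -> u2 != u3 -> wof u3 != wof u1 -> wof u3 != wof u2 ->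
  ~~ two z -> (forall n, e z n = [|| n == u1, n == u2 | n == u3]) -> False.
Proof.
move=> u1t u2t u3t u12 u13 u23 w31 w32 z2 zn.
have u1z : e u1 z by rewrite e_sym zn eqxx.
have u2z : e u2 z by rewrite e_sym zn eqxx orbT.
have u3z : e u3 z by rewrite e_sym zn eqxx !orbT.
apply: (@irreducible (z |: ((leaf u1 :|: leaf u2) :|: leaf u3))).
  by apply/set0Pn; exists z; rewrite in_setU in_set1 eqxx.
move=> f; have [p [p5 _ pc]] := leaves_bans f u1t u2t u12 u1z u2z z2.
have [|c _] := @pick_color predT (fun c => p c || bans (leaf u3) set0 z f c).
  rewrite count_colors; apply: leq_ltn_trans (count_or (m := 5) (n := 2) _ _) _ => //.
  exact: leaf_bans0.
rewrite negb_or negbK => /andP[/pc ec e3].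
apply: (@ext_add _ _ _ _ c); rewrite ?in_set0 //.
- by rewrite in_setU negb_or in_setU negb_or !notin_leaf.
- by move=> n; rewrite zn => /or3P[] /eqP->; rewrite !inE eqxx ?orbT.
apply: ext_union ec e3; last exact: disjoint_set0.
by apply: separateU; apply: leaf_separate0; rewrite // eq_sym.
Qed.

(** At most two of the leaves share a neighbour of degree 2, so some numbering makes the third one
    separate. *)
Lemma three_leaves z u1 u2 u3 : t31 u1 -> t31 u2 -> t31 u3 ->
  u1 != u2 -> u1 != u3 -> u2 != u3 ->
  ~~ two z -> (forall n, e z n = [|| n == u1, n == u2 | n == u3]) -> False.
Proof.
move=> u1t u2t u3t u12 u13 u23 z2 zn.
case: (eqVneq (wof u3) (wof u1)) => [w31|w31]; last first.
  case: (eqVneq (wof u3) (wof u2)) => [w32|w32]; last first.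
    exact: (@three_leaves_distinct z u1 u2 u3).
  have w13 : wof u1 != wof u3 by rewrite eq_sym.
  apply: (@three_leaves_distinct z u2 u3 u1); rewrite -?w32 // 1?eq_sym //.
  by move=> n; rewrite zn orbC -orbA.
have w21 : wof u2 != wof u1.
  by apply: contraNneq u23 => w21; apply/eqP; apply: (@wof_triple u1).
apply: (@three_leaves_distinct z u1 u3 u2); rewrite ?w31 // 1?eq_sym //.
by move=> n; rewrite zn [(n == u3) || _]orbC.
Qed.


(** * A vertex next to a weak vertex and to a leaf or another weak vertex *)

Lemma setU1_neq0 x X : x |: X != set0.
Proof. by apply/set0Pn; exists x; rewrite setU11. Qed.

Lemma branch_notin z v u1 u2 : e v z -> ~~ two z ->
  t31 u1 -> t31 u2 -> ~~ e z u1 -> ~~ e z u2 -> z != u1 -> z != u2 ->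
  z \notin branch v u1 u2.
Proof.
move=> vz z2 u1t u2t zu1 zu2 n1 n2; have [_ w1 _] := wofP u1t; have [_ w2 _] := wofP u2t.
rewrite !inE !negb_or n1 n2 eq_sym edge_neq //=.
by apply/andP; split; apply: contraNneq z2 => ->.
Qed.

(* [z] is coloured when at least two of its colours agree
   with the neighbours [y] and [x], and then the branch hanging from [v]. *)
Lemma ext_root_branch z v u1 u2 x y f :
  t31 u1 -> t31 u2 -> u1 != u2 -> t30 v -> t30 z ->
  (forall n, e v n = [|| n == u1, n == u2 | n == z]) -> ~~ e z u1 -> ~~ e z u2 ->
  (forall n, e z n -> [|| n == v, n == x | n == y]) ->
  1 < count (fun c => compat (s z y) c (f y) && compat (s z x) c (f x)) colors ->
  ext (z |: branch v u1 u2) set0 f.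
Proof.
move=> u1t u2t u12 v3 z3 vn zu1 zu2 zn good.
have vz : e v z by rewrite vn eqxx !orbT.
have := leq_ltn_trans (branch_bans f u1t u2t u12 v3 z3 vn zu1 zu2) good.
case/pick_color=> c /andP[cy cx]; rewrite negbK; apply: ext_add; rewrite ?in_set0 //.
  apply: branch_notin => //; first exact: t30_two.
    by apply: contraTneq z3 => ->; apply: contraTN u1t; apply: t30_t31.
  by apply: contraTneq z3 => ->; apply: contraTN u2t; apply: t30_t31.
move=> n /zn /or3P[] /eqP-> // nY _.
by rewrite /branch setU11 in nY.
Qed.

(** Of the four colours that [y] leaves to [z], the branch bans at most one and the leaf [x] at most
    two. *)
Lemma branch_leaf_disjoint z v u1 u2 x y :
  t31 u1 -> t31 u2 -> u1 != u2 -> t30 v -> t30 z ->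
  (forall n, e v n = [|| n == u1, n == u2 | n == z]) -> ~~ e z u1 -> ~~ e z u2 ->
  (forall n, e z n = [|| n == v, n == x | n == y]) ->
  t31 x -> x != u1 -> x != u2 -> wof u1 != wof x -> wof u2 != wof x -> False.
Proof.
move=> u1t u2t u12 v3 z3 vn zu1 zu2 zn xt xu1 xu2 w1x w2x.
have vz : e v z by rewrite vn eqxx !orbT.
have xz : e x z by rewrite e_sym zn eqxx orbT.
apply: (@irreducible (z |: (branch v u1 u2 :|: leaf x))); first exact: setU1_neq0.
move=> f; have [|c cy] := @pick_color (fun c => compat (s z y) c (f y))
  (fun c => bans (branch v u1 u2) set0 z f c || bans (leaf x) set0 z f c).
  rewrite count_compat; apply: leq_ltn_trans (count_or (m := 1) (n := 2) _ _) _ => //.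
    exact: branch_bans.
  by apply: leaf_bans0 => //; apply: t30_two.
have t31_neq a b : t30 a -> t31 b -> a != b.
  by move=> a3; apply: contraTneq => <-; apply: t30_t31.
rewrite negb_or !negbK => /andP[eb ex]; apply: (@ext_add _ _ _ _ c); rewrite ?in_set0 //.
- rewrite in_setU negb_or notin_leaf ?t30_two // andbT.
  by apply: branch_notin; rewrite ?t30_two ?t31_neq.
- move=> n; rewrite zn => /or3P[] /eqP-> // nY _.
    by rewrite !inE eqxx in nY.
  by rewrite !inE eqxx !orbT in nY.
apply: ext_union eb ex; last exact: disjoint_set0.
apply: separateU; last by apply: separateU; apply: leaf_separate0; rewrite // eq_sym.
have [_ wx2 _] := wofP xt.
move=> a b; rewrite !inE => /eqP-> /orP[] /eqP->.
  rewrite t31_neq //= vn (negbTE xu1) (negbTE xu2) /=.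
  by rewrite eq_sym t31_neq.
apply/andP; split; first by apply: contraTneq wx2 => <-; apply: t30_two.
by apply: contraL wx2; apply: t30_nbr.
Qed.

(** The leaf [x] is coloured first, by [good_compat_near], so that [z] keeps two colours; [wof x] is
    coloured with the branch. *)
Lemma branch_leaf_shared z v u1 u2 x y :
  t31 u1 -> t31 u2 -> u1 != u2 -> t30 v -> t30 z ->
  (forall n, e v n = [|| n == u1, n == u2 | n == z]) -> ~~ e z u1 -> ~~ e z u2 ->
  (forall n, e z n = [|| n == v, n == x | n == y]) -> y != x ->
  t31 x -> x != u1 -> x != u2 -> (wof x == wof u1) || (wof x == wof u2) -> False.
Proof.
move=> u1t u2t u12 v3 z3 vn zu1 zu2 zn yx xt xu1 xu2 wx.
have xz : e x z by rewrite e_sym zn eqxx orbT.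
have [y' [t [y'z xy' xn _ _]]] := leaf_nbrs xt xz (t30_two z3).
apply: (@irreducible (x |: (z |: branch v u1 u2))); first exact: setU1_neq0.
move=> f; have [c cy' good] :=
  good_compat_near (s z y) (s z x) (s x y') (f y) (f y').
have [_ w2 _] := wofP xt.
have ntwo a : t31 a -> x != wof a.
  by move=> ta; apply: contraNneq (t31_two xt) => ->; have [] := wofP ta.
apply: (@ext_add _ _ _ _ c); rewrite ?in_set0 //.
- rewrite !inE !negb_or edge_neq // xu1 xu2 !ntwo //= andbT.
  by apply: contraTneq v3 => <-; apply: contraTN xt; apply: t30_t31.
- move=> n; rewrite xn => /or3P[] /eqP-> // nY _.
    by rewrite !inE eqxx in nY.
  by move: nY; rewrite !inE; case/orP: wx => /eqP->; rewrite eqxx !orbT.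
apply: (@ext_root_branch _ _ _ _ x y) => //; first by move=> n; rewrite zn.
by rewrite upd_same upd_other.
Qed.

(** Here [z], [v], [u1] form a triangle. The colour of [v] is chosen first, to suit [leaf u2],
    followed by [z], [u1] and [wof u1], with the counts of [triangle_compat]. *)
Lemma branch_triangle z v u1 u2 y :
  t31 u1 -> t31 u2 -> u1 != u2 -> t30 v -> t30 z ->
  (forall n, e v n = [|| n == u1, n == u2 | n == z]) ->
  (forall n, e z n = [|| n == v, n == u1 | n == y]) -> y != v -> y != u1 -> y != u2 ->
  False.
Proof.
move=> u1t u2t u12 v3 z3 vn zn yv yu1 yu2.
have [u1w w12 _] := wofP u1t; have [u2w w22 _] := wofP u2t.
have vz : e v z by rewrite vn eqxx !orbT.
have u1v : e u1 v by rewrite e_sym vn eqxx.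
have u2v : e u2 v by rewrite e_sym vn eqxx orbT.
have u1z : e u1 z by rewrite e_sym zn eqxx orbT.
have zy : e z y by rewrite zn eqxx !orbT.
have ntwo a b : ~~ two a -> two b -> a != b.
  by move=> a2; apply: contraTneq => <-.
have v2 := t30_two v3; have z2 := t30_two z3; have y2 := t30_nbr z3 zy.
have t31_neq a b : t30 a -> t31 b -> a != b.
  by move=> a3; apply: contraTneq => <-; apply: t30_t31.
have u1n n : e u1 n = [|| n == v, n == z | n == wof u1].
  have vz' := edge_neq vz; have [c [cv cz _ un]] := three_nbrs (t31_deg u1t) u1v u1z vz'.
  move: (u1w); rewrite !un ![wof u1 == _]eq_sym (negbTE (ntwo _ _ v2 w12)).
  by rewrite (negbTE (ntwo _ _ z2 w12)) /= => /eqP->.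
(* A vertex of degree 2 shared by [u1] and [u2] thus belongs to the deferred part. *)
pose D := z |: leaf u1; pose L := leaf u2 :\: D.
have vD : v \notin D.
  by rewrite in_setU1 negb_or notin_leaf // edge_neq.
have vL : v \notin L by rewrite in_setD negb_and notin_leaf ?orbT.
apply: (@irreducible (v |: (L :|: D))); first exact: setU1_neq0.
move=> f; have := leq_ltn_trans (leaf_bans D f u2t u2v v2)
  (triangle_compat (s z y) (s z v) (s u1 z) (s u1 v) (f y)).
case/pick_color=> c /has_colorsP[d /and3P[dy dc good]] /negPn/extP[g [gf gL]].
apply: (@ext_add _ _ _ _ c); rewrite ?in_set0 //.
- by rewrite in_setU negb_or vL vD.
- move=> n; rewrite vn => /or3P[] /eqP-> nY _.
  + by rewrite !inE eqxx !orbT in nY.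
  + move: nY; rewrite in_setU negb_or in_setD !negb_and negbK => /andP[/orP[->|]] //.
    by rewrite !inE eqxx.
  + by rewrite !inE eqxx !orbT in nY.
apply: (ext_seq (disjoint_setD _ _) (disjoint_set0 _) gf) => [x n xL xn nD _|]; first exact: gL.
have gv : g v = c by rewrite gf // upd_same.
have gy : g y = f y.
  by rewrite gf ?upd_other // in_setD !inE !negb_or (negbTE yu2) (negbTE (ntwo _ _ y2 w22)) andbF.
apply: (@ext_add _ _ _ _ d); rewrite ?in_set0 //.
- by apply: notin_leaf.
- move=> n; rewrite zn => /or3P[] /eqP-> nY _; rewrite ?gv ?gy //.
  by rewrite !inE eqxx in nY.
have w1u1 : e (wof u1) u1 by rewrite e_sym.
have w1_0 : wof u1 \notin set0 by rewrite inE.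
have := leq_ltn_trans (two_bans (upd g z d) w12 w1u1 w1_0) good.
case/pick_color=> b /andP[bd bc] /negPn eb.
apply: (@ext_add _ _ _ _ b); rewrite ?in_set0 //.
- by rewrite inE ntwo // t31_two.
- move=> n; rewrite u1n => /or3P[] /eqP-> nY _.
  + by rewrite upd_other ?gv // edge_neq.
  + by rewrite upd_same.
  + by rewrite inE eqxx in nY.
Qed.


(** The leaves are coloured first so that their neighbours of degree 2 stay colourable, which for a
    suitable [c1] bans at most one colour [c2]; [two_triangles_compat] offers two. *)
Lemma double_triangle z x u1 u2 :
  t31 u1 -> t31 u2 -> u1 != u2 -> t30 x -> t30 z ->
  (forall n, e x n = [|| n == u1, n == u2 | n == z]) ->
  (forall n, e z n = [|| n == u1, n == u2 | n == x]) -> False.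
Proof.
move=> u1t u2t u12 x3 z3 xn zn.
have [u1w w12 _] := wofP u1t; have [u2w w22 _] := wofP u2t.
have w1u1 : e (wof u1) u1 by rewrite e_sym.
have w2u2 : e (wof u2) u2 by rewrite e_sym.
have ntwo a b : ~~ two a -> two b -> a != b by move=> a2; apply: contraTneq => <-.
have u1x : e u1 x by rewrite e_sym xn eqxx.
have u1z : e u1 z by rewrite e_sym zn eqxx.
have u2x : e u2 x by rewrite e_sym xn eqxx orbT.
have u2z : e u2 z by rewrite e_sym zn eqxx orbT.
have xz : e x z by rewrite xn eqxx !orbT.
have [x2 z2] := (t30_two x3, t30_two z3).
have nxz := edge_neq xz.
have un u : t31 u -> e u x -> e u z -> forall n, e u n = [|| n == x, n == z | n == wof u].
  move=> ut ux uz n; have [uw w2 _] := wofP ut.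
  have [c [_ _ _ nu]] := three_nbrs (t31_deg ut) ux uz nxz.
  move: (uw); rewrite !nu ![wof u == _]eq_sym (negbTE (ntwo _ _ x2 w2)).
  by rewrite (negbTE (ntwo _ _ z2 w2)) /= => /eqP->.
pose W := [set wof u1; wof u2].
have wW u : u \in W -> two u by rewrite !inE => /orP[] /eqP->.
have notW a : ~~ two a -> a \notin W by apply: contra; apply: wW.
apply: (@irreducible (u1 |: (u2 |: (z |: (x |: W))))); first exact: setU1_neq0.
move=> f.
have [c1 [p [p1 pW]]] : exists c1 (p : pred color), count p colors <= 1 /\
    forall c2, ~~ p c2 -> ext W set0 (upd (upd f u1 c1) u2 c2).
  have w1_0 : wof u1 \notin set0 by rewrite inE.
  have w2_0 : wof u2 \notin set0 by rewrite inE.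
  case: (eqVneq (wof u1) (wof u2)) => [ww|ww].
    (* An arbitrary colour for [u1]: the common neighbour of degree 2 restricts only the pair. *)
    exists (1%R, true), (bans [set wof u2] set0 u2 (upd f u1 (1%R, true))).
    by split=> [|c2 /negPn]; [exact: two_bans | rewrite /W ww setUid].
  have ten : 1 < count predT colors by rewrite count_colors.
  have [c1 _ /negPn ew1] := pick_color (leq_ltn_trans (two_bans f w12 w1u1 w1_0) ten).
  exists c1, (bans [set wof u2] set0 u2 f); split=> [|c2 /negPn ew2].
    exact: two_bans.
  apply: ext_union; [|exact: disjoint_set0| |].
  - by move=> a b; rewrite !inE => /eqP-> /eqP->; rewrite ww two_two.
  - apply: ext_congr ew1 => a n; rewrite inE => /eqP-> wn _ _.
    rewrite [RHS]upd_other //; apply: contraNneq ww => En; rewrite En in wn.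
    by have [_ _ u2u] := wofP u2t; apply/eqP/u2u; rewrite // e_sym.
  apply: ext_congr ew2 => a n; rewrite inE => /eqP-> wn _ _.
  rewrite !updE; case: eqP => // _; case: eqP => // En; rewrite En in wn.
  case/eqP: ww; have [_ _ u1u] := wofP u1t.
  by rewrite [RHS]u1u // e_sym.
have := leq_ltn_trans p1 (two_triangles_compat (s z u1) (s z u2) (s x u1) (s x u2) (s x z) c1).
case/pick_color=> c2 /has_colorsP[d /and3P[d1 d2]] /has_colorsP[b /and3P[b1 b2 bd]].
move=> /pW eW.
have t31_neq a b' : t30 a -> t31 b' -> b' != a.
  by move=> a3 b't; apply: contraTneq a3 => <-; apply: contraTN b't; apply: t30_t31.
apply: (@ext_add _ _ _ _ c1); rewrite ?in_set0 //.
- by rewrite 3!in_setU1 !negb_or u12 !t31_neq ?notW ?t31_two.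
- move=> n; rewrite un // => /or3P[] /eqP-> nY _; move: nY.
  + by rewrite !inE eqxx ?orbT.
  + by rewrite !inE eqxx ?orbT.
  + by rewrite !inE eqxx ?orbT.
apply: (@ext_add _ _ _ _ c2); rewrite ?in_set0 //.
- by rewrite 2!in_setU1 !negb_or !t31_neq ?notW ?t31_two.
- move=> n; rewrite un // => /or3P[] /eqP-> nY _; move: nY.
  + by rewrite !inE eqxx ?orbT.
  + by rewrite !inE eqxx ?orbT.
  + by rewrite !inE eqxx ?orbT.
apply: (@ext_add _ _ _ _ d); rewrite ?in_set0 //.
- by rewrite in_setU1 negb_or eq_sym nxz notW.
- move=> n; rewrite zn => /or3P[] /eqP-> nY _.
  + by rewrite upd_other // upd_same.
  + by rewrite upd_same.
  + by rewrite !inE eqxx in nY.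
apply: (@ext_add _ _ _ _ b); rewrite ?in_set0 //.
- exact: notW.
- have u1z' := t31_neq _ _ z3 u1t; have u2z' := t31_neq _ _ z3 u2t.
  move=> n; rewrite xn => /or3P[] /eqP-> nY _.
  + by rewrite upd_other // upd_other // upd_same.
  + by rewrite upd_other // upd_same.
  + by rewrite upd_same.
apply: ext_congr eW => a n /wW a2 an _ _; rewrite !(updE _ x) (updE _ z).
have nn q : t30 q -> n != q.
  by move=> q3; apply: contraTneq an => ->; rewrite e_sym; apply: contraTN a2; apply: t30_nbr.
by rewrite !(negbTE (nn _ _)).
Qed.

(** [v2] is coloured first: the five colours leaving two for [z] exceed the four bans of [u3] and
    [u4] with [D] deferred; then come [z] and the branch at [v1]. The leaf [u3] may itself be [u1]
    or [u2]. *)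
Lemma two_branches_shared z v1 v2 y u1 u2 u3 u4 :
  t31 u1 -> t31 u2 -> u1 != u2 -> t31 u3 -> t31 u4 -> u3 != u4 ->
  t30 v1 -> t30 v2 -> t30 z ->
  (forall n, e v1 n = [|| n == u1, n == u2 | n == z]) ->
  (forall n, e v2 n = [|| n == u3, n == u4 | n == z]) ->
  (forall n, e z n = [|| n == v1, n == v2 | n == y]) -> v1 != v2 -> y != v2 ->
  ~~ t31 y -> (wof u3 == wof u1) || (wof u3 == wof u2) -> False.
Proof.
move=> u1t u2t u12 u3t u4t u34 v13 v23 z3 v1n v2n zn v12 yv2 yt w3.
have v2z : e v2 z by rewrite v2n eqxx !orbT.
have v1z : e v1 z by rewrite v1n eqxx !orbT.
have t31_neq a b : t30 a -> t31 b -> a != b.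
  by move=> a3; apply: contraTneq => <-; apply: t30_t31.
have zu u : t31 u -> ~~ e z u.
  move=> ut; rewrite zn !negb_or ![u == _]eq_sym 2?t31_neq //=.
  by apply: contraNneq yt => ->.
have zy : e z y by rewrite zn eqxx !orbT.
have u3v : e u3 v2 by rewrite e_sym v2n eqxx.
have u4v : e u4 v2 by rewrite e_sym v2n eqxx orbT.
have v22 := t30_two v23.
pose D := z |: branch v1 u1 u2.
have w3D : wof u3 \in D by rewrite !inE; case/orP: w3 => /eqP->; rewrite eqxx !orbT.
have v2D : v2 \notin D.
  rewrite in_setU1 in_setU1 in_setU !negb_or edge_neq // eq_sym v12 /=.
  have nl u : t31 u -> v2 \notin leaf u.
    move=> ut; rewrite !inE negb_or t31_neq //=.
    by apply: contraNneq v22 => ->; have [] := wofP ut.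
  by rewrite !nl.
pose L := (leaf u3 :\: D) :|: (leaf u4 :\: D).
have v2L : v2 \notin L.
  by rewrite in_setU !in_setD negb_or !negb_and !notin_leaf ?orbT.
apply: (@irreducible (v2 |: (L :|: D))); first exact: setU1_neq0.
move=> f.
have := count_or (leaf_bans D f u3t u3v v22) (leaf_bans D f u4t u4v v22).
rewrite -ltnS -[X in _ < X](good_compat (s z y) (s z v2) (f y)).
case/pick_color=> c good; rewrite negb_or => /andP[/negPn e3 /negPn e4].
have /extP[g [gf gL]] : ext L D (upd f v2 c).
  apply: ext_union e3 e4; last exact: disjoint_setD.
  exact: leaf_separate.
have LD : [disjoint L & D] by rewrite /L -setDUl disjoint_setD.
apply: (@ext_add _ _ _ _ c); rewrite ?in_set0 //.
- by rewrite in_setU negb_or v2L.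
- have uL u : u \in leaf u by rewrite !inE eqxx.
  move=> n; rewrite v2n => nn; suff -> : n \in L :|: D by [].
  rewrite in_setU orbC; case: (boolP (n \in D)) => //= nD; rewrite in_setU !in_setD nD.
  by case/or3P: nn nD => /eqP->; rewrite ?uL ?orbT // setU11.
apply: (ext_seq LD (disjoint_set0 _) gf) => [a n aL an nD _|]; first exact: gL.
apply: (@ext_root_branch _ _ _ _ v2 y) => //; rewrite ?zu //; first by move=> n; rewrite zn.
rewrite gf //; last first.
  have nl u : t31 u -> y \notin leaf u.
    move=> ut; rewrite !inE negb_or; apply/andP; split.
      by apply: contraNneq yt => ->.
    by apply: contraNneq (t30_nbr z3 zy) => ->; have [] := wofP ut.
  by rewrite in_setU !in_setD negb_or !negb_and !nl ?orbT.
by rewrite gf // upd_same upd_other.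
Qed.

(** Of the four colours that [y] leaves to [z], each branch bans at most one; distinct neighbours of
    degree 2 keep the branches separate. *)
Lemma two_branches_disjoint z v1 v2 y u1 u2 u3 u4 :
  t31 u1 -> t31 u2 -> u1 != u2 -> t31 u3 -> t31 u4 -> u3 != u4 ->
  t30 v1 -> t30 v2 -> t30 z ->
  (forall n, e v1 n = [|| n == u1, n == u2 | n == z]) ->
  (forall n, e v2 n = [|| n == u3, n == u4 | n == z]) ->
  (forall n, e z n = [|| n == v1, n == v2 | n == y]) -> v1 != v2 ->
  ~~ t31 y -> wof u3 != wof u1 -> wof u3 != wof u2 ->
  wof u4 != wof u1 -> wof u4 != wof u2 -> False.
Proof.
move=> u1t u2t u12 u3t u4t u34 v13 v23 z3 v1n v2n zn v12 yt w31 w32 w41 w42.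
have v2z : e v2 z by rewrite v2n eqxx !orbT.
have v1z : e v1 z by rewrite v1n eqxx !orbT.
have t31_neq a b : t30 a -> t31 b -> a != b.
  by move=> a3; apply: contraTneq => <-; apply: t30_t31.
have zu u : t31 u -> ~~ e z u.
  move=> ut; rewrite zn !negb_or ![u == _]eq_sym 2?t31_neq //=.
  by apply: contraNneq yt => ->.
have z2 := t30_two z3.
apply: (@irreducible (z |: (branch v1 u1 u2 :|: branch v2 u3 u4))).
  exact: setU1_neq0.
move=> f; have [|c cy] := @pick_color (fun c => compat (s z y) c (f y)) (fun c =>
    bans (branch v1 u1 u2) set0 z f c || bans (branch v2 u3 u4) set0 z f c).
  rewrite count_compat; apply: leq_ltn_trans (count_or (m := 1) (n := 1) _ _) _ => //;
    by apply: branch_bans; rewrite ?zu.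
rewrite negb_or !negbK => /andP[e1 e2]; apply: (@ext_add _ _ _ _ c); rewrite ?in_set0 //.
- by rewrite in_setU negb_or !branch_notin ?zu ?t31_neq.
- move=> n; rewrite zn => /or3P[] /eqP-> // nY _.
    by rewrite !inE eqxx in nY.
  by rewrite !inE eqxx !orbT in nY.
have wneq a u : t30 a -> t31 u -> a != wof u.
  move=> a3 ut; have [_ w2 _] := wofP ut.
  by apply: contraTneq w2 => <-; apply: t30_two.
have wedge a u : t30 a -> t31 u -> ~~ e a (wof u).
  by move=> a3 ut; have [_ w2 _] := wofP ut; apply: contraL w2; apply: t30_nbr.
have leaf_neq a b : t31 a -> t31 b -> wof a != wof b -> a != b.
  by move=> _ _; apply: contraNneq => ->.
have uv a b w u u' : t30 a -> t30 b -> t31 w -> t31 u -> t31 u' ->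
    (forall n, e a n = [|| n == u, n == u' | n == z]) ->
    wof w != wof u -> wof w != wof u' -> separate [set a] (leaf w).
  move=> a3 b3 wt ut u't an wu wu' p q; rewrite !inE => /eqP-> /orP[] /eqP->.
    rewrite t31_neq // an !negb_or (leaf_neq _ _ wt ut wu) (leaf_neq _ _ wt u't wu').
    by rewrite eq_sym t31_neq.
  by rewrite wneq // wedge.
have vv : separate [set v1] [set v2].
  move=> a b; rewrite !inE => /eqP-> /eqP->; rewrite v12 v1n !negb_or.
  by rewrite (t31_neq _ u1) // (t31_neq _ u2) // edge_neq.
apply: ext_union e1 e2; last exact: disjoint_set0.
have sepv1 u : t31 u -> wof u != wof u1 -> wof u != wof u2 -> separate (branch v1 u1 u2) (leaf u).
  move=> ut wu1 wu2; apply: separateU; first exact: (@uv v1 v2 u u1 u2).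
  by apply: separateU; apply: leaf_separate0; rewrite // eq_sym // leaf_neq.
apply: separateC; apply: separateU; last first.
  by apply: separateU; apply: separateC; apply: sepv1.
apply: separateC; apply: separateU => //.
apply: separateU; apply: separateC; apply: (@uv v2 v1 _ u3 u4); rewrite // eq_sym //.
Qed.


(** * Neighbours of weak vertices *)

Lemma weak_leaves v : weak v -> exists u1 u2 z,
  [/\ t31 u1, t31 u2, u1 != u2, ~~ t31 z &
      forall n, e v n = [|| n == u1, n == u2 | n == z]].
Proof.
case/andP=> v3 /card_gt1P[u1 [u2 []]]; rewrite !inE => /andP[vu1 u1t] /andP[vu2 u2t] u12.
have [z [zu1 zu2 vz vn]] := three_nbrs (t30_deg v3) vu1 vu2 u12.
exists u1, u2, z; split=> //; apply/negP => zt.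
have v2 := t30_two v3; rewrite eq_sym in zu1; rewrite eq_sym in zu2.
exact: (three_leaves u1t u2t zt u12 zu1 zu2 v2 vn).
Qed.

Lemma weak_leaf z v x : t30 z -> e z v -> weak v -> e z x -> t31 x -> False.
Proof.
move=> z3 zv vw zx xt; have v3 := weak_t30 vw.
have [u1 [u2 [z' [u1t u2t u12 z't vn]]]] := weak_leaves vw.
have t31_neq a b : t30 a -> t31 b -> b != a.
  by move=> a3 bt; apply: contraTneq a3 => <-; apply: contraTN bt; apply: t30_t31.
have Ez : z' = z.
  move: zv; rewrite e_sym vn ![z == _]eq_sym (negbTE (t31_neq _ _ z3 u1t)).
  by rewrite (negbTE (t31_neq _ _ z3 u2t)) => /eqP.
rewrite {z' z't}Ez in vn.
have vx : v != x by rewrite eq_sym t31_neq.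
(* This settles the case where a neighbour [y] of [z] is no leaf of [v]. If [x] is no leaf of [v]
   but the third neighbour is, the two exchange roles; if both are, the double triangle remains. *)
have core x' y : t31 x' -> y != u1 -> y != u2 -> y != v -> y != x' ->
    (forall n, e z n = [|| n == v, n == x' | n == y]) -> False.
  move=> x't yu1 yu2 yv yx' zn.
  case: (eqVneq x' u1) => [Ex|x'u1].
    by rewrite Ex in zn yx'; apply: (branch_triangle u1t u2t u12 v3 z3 vn zn).
  case: (eqVneq x' u2) => [Ex|x'u2].
    rewrite Ex in zn yx'.
    apply: (branch_triangle u2t u1t _ v3 z3 _ zn) => //; rewrite 1?eq_sym // => n.
    by rewrite vn orbCA.
  have zu1 : ~~ e z u1 by rewrite zn !negb_or t31_neq // ![u1 == _]eq_sym x'u1.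
  have zu2 : ~~ e z u2 by rewrite zn !negb_or t31_neq // ![u2 == _]eq_sym x'u2.
  case: (boolP ((wof x' == wof u1) || (wof x' == wof u2))) => [w|].
    exact: (branch_leaf_shared u1t u2t u12 v3 z3 vn zu1 zu2 zn).
  rewrite negb_or ![wof x' == _]eq_sym => /andP[w1 w2].
  exact: (branch_leaf_disjoint u1t u2t u12 v3 z3 vn zu1 zu2 zn).
have [y [yv yx zy zn]] := three_nbrs (t30_deg z3) zv zx vx.
have zn' n : e z n = [|| n == v, n == y | n == x] by rewrite zn [(n == x) || _]orbC.
case: (boolP ((y == u1) || (y == u2))) => [yu|]; last first.
  by rewrite negb_or => /andP[yu1 yu2]; apply: (core x y).
have yt : t31 y by case/orP: yu => /eqP->.
case: (boolP ((x == u1) || (x == u2))) => [xu|]; last first.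
  by rewrite negb_or => /andP[xu1 xu2]; apply: (core y x); rewrite // eq_sym.
apply: (double_triangle u1t u2t u12 v3 z3 vn) => n; rewrite zn.
case/orP: xu yx => /eqP-> ; case/orP: yu => /eqP->; rewrite ?eqxx // => _;
  by case: (n == v); case: (n == u1); case: (n == u2).
Qed.

(** By [weak_leaf] the third neighbour of [z] is not a leaf; the two branches share a vertex of
    degree 2 or are separate. *)
Lemma weak_weak z v1 v2 :
  t30 z -> e z v1 -> weak v1 -> e z v2 -> weak v2 -> v1 != v2 -> False.
Proof.
move=> z3 zv1 v1w zv2 v2w v12.
have [y [yv1 yv2 zy zn]] := three_nbrs (t30_deg z3) zv1 zv2 v12.
case: (boolP (t31 y)) => yt; first exact: (@weak_leaf z v1 y).
have t31_neq a b : t30 a -> t31 b -> b != a.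
  by move=> a3 bt; apply: contraTneq a3 => <-; apply: contraTN bt; apply: t30_t31.
have leaves v : e z v -> weak v -> exists u1 u2, [/\ t31 u1, t31 u2, u1 != u2 &
    forall n, e v n = [|| n == u1, n == u2 | n == z]].
  move=> zv vw; have [u1 [u2 [z' [u1t u2t u12 z't vn]]]] := weak_leaves vw.
  suff Ez : z' = z by exists u1, u2; split=> // n; rewrite vn Ez.
  move: zv; rewrite e_sym vn ![z == _]eq_sym (negbTE (t31_neq _ _ z3 u1t)).
  by rewrite (negbTE (t31_neq _ _ z3 u2t)) => /eqP.
have [u1 [u2 [u1t u2t u12 v1n]]] := leaves _ zv1 v1w.
have [u3 [u4 [u3t u4t u34 v2n]]] := leaves _ zv2 v2w.
have [v13 v23] := (weak_t30 v1w, weak_t30 v2w).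
case: (boolP ((wof u3 == wof u1) || (wof u3 == wof u2))) => [w3|].
  by apply: (two_branches_shared u1t u2t u12 u3t u4t u34 v13 v23 z3 v1n v2n zn).
case: (boolP ((wof u4 == wof u1) || (wof u4 == wof u2))) => [w4 _|].
  have v2n' n : e v2 n = [|| n == u4, n == u3 | n == z] by rewrite v2n orbCA.
  rewrite eq_sym in u34.
  by apply: (two_branches_shared u1t u2t u12 u4t u3t u34 v13 v23 z3 v1n v2n' zn).
rewrite !negb_or => /andP[w41 w42] /andP[w31 w32].
by apply: (two_branches_disjoint u1t u2t u12 u3t u4t u34 v13 v23 z3 v1n v2n zn).
Qed.

(** * Discharging *)

(* In units of 1/7, [v] has initial charge [7 * deg v - 20], and
   [give u v] is sent from [u] to [v]. *)
Definition give u v : nat :=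
  if e u v && ~~ two u then
    if two v then 3 else t31 v || (weak v && ~~ t31 u)
  else 0.

Lemma sum_three v a b c (F : T -> nat) :
  a != b -> c != a -> c != b -> (forall n, e v n = [|| n == a, n == b | n == c]) ->
  \sum_(n | e v n) F n = F a + (F b + F c).
Proof.
move=> ab ca cb vn; rewrite (bigD1 a) ?vn ?eqxx //=; congr (_ + _).
rewrite (bigD1 b) ?vn ?eqxx ?orbT //= 1?eq_sym //; congr (_ + _).
rewrite (big_pred1 c) // => n; rewrite vn /=.
case: (eqVneq n c) => [->|_]; first by rewrite ca cb !orbT.
by case: (eqVneq n a); case: (eqVneq n b); rewrite ?andbF.
Qed.

Lemma give_out v : \sum_n give v n = \sum_(n | e v n) give v n.
Proof.
by rewrite [RHS]big_mkcond; apply: eq_bigr => n _; rewrite /give; case: (e v n).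
Qed.

Lemma give_in v : \sum_n give n v = \sum_(n | e v n) give n v.
Proof.
by rewrite [RHS]big_mkcond; apply: eq_bigr => n _; rewrite /give e_sym; case: (e v n).
Qed.

Lemma deg_sum v : deg v = \sum_(n | e v n) 1.
Proof. by rewrite sum1dep_card. Qed.

Lemma twos_sum v : #|twos v| = \sum_(n | e v n) two n.
Proof.
by rewrite -big_mkcondr sum1dep_card; apply: eq_card => n; rewrite !inE.
Qed.

(** In sevenths, degree 2: -6 + 3 + 3; leaf: 1 + 1 + 1 - 3; weak vertex: 1 + 1 - 2. Any other vertex
    of degree 3 starts with 1 and has at most one recipient. Degree 4: 8 against at most 3 + 3 + 1 +
    1. From degree 5 on, [7 * d - 20] is at least [3 * d]. *)
Lemma discharge v : 20 + \sum_n give v n <= 7 * deg v + \sum_n give n v.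
Proof.
rewrite give_out give_in; have v_gt1 := deg_gt1 v.
case: (boolP (two v)) => v2.
  rewrite [X in 20 + X]big1 => [|n vn]; last by rewrite /give v2 andbF.
  rewrite [X in _ <= _ + X](eq_bigr (fun=> 3)) => [|n vn].
    by rewrite -[X in _ <= _ + X]/(\sum_(n | e v n) 3) sum_nat_const
      -[#|_|]/(#|e v|) -cardsE -/(deg v) (eqP v2).
  by rewrite /give e_sym vn v2 (contraL (two_two v2 (w' := n))) ?vn.
case: (leqP (deg v) 3) => [v3|v4]; last first.
  have le_out : \sum_(n | e v n) give v n <= deg v + 2 * #|twos v|.
    rewrite deg_sum twos_sum big_distrr -big_split /=; apply: leq_sum => n vn.
    by rewrite /give vn v2 /=; case: (two n) => //=; case: (_ || _).
  have le_tw : #|twos v| <= deg v by apply/subset_leq_card/subsetP => n; rewrite !inE => /andP[].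
  apply: leq_trans (leq_addr _ _); apply: leq_trans (leq_add (leqnn _) le_out) _.
  case: (leqP (deg v) 4) => [v4'|v5]; last by lia.
  by have := twos_bound v4'; lia.
have {}v3 : deg v = 3.
  by move: v3 v_gt1 v2; rewrite /two; case: (deg v) => [|[|[|[|]]]].
have: #|twos v| <= 1 by have := @twos_bound v; rewrite v3 addn2; apply.
rewrite v3; rewrite leq_eqVlt ltnS leqn0 => /orP[vt|vt].
  have {}vt : t31 v by rewrite /t31 v3 vt.
  have [vw w2 vn2] := wofP vt.
  have [y vy yw] : exists2 y, e v y & y != wof v.
    have : 0 < #|nb v :\ wof v|.
      by move: v3; rewrite /deg (cardsD1 (wof v)) inE vw add1n => -[->].
    by case/card_gt0P=> y; rewrite !inE => /andP[yw vy]; exists y.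
  rewrite eq_sym in yw; have [x [xw xy vx vn]] := three_nbrs v3 vw vy yw.
  rewrite !(sum_three _ yw xw xy vn) /give vw vx vy ![e _ v]e_sym vw vx vy v2 vt w2 /=.
  have nt n : e v n -> n != wof v -> ~~ two n.
    by move=> vn' nw; apply: contra nw => n2; apply/eqP/vn2.
  rewrite (negbTE (nt x vx xw)) (negbTE (nt y vy _)) 1?eq_sym //=.
  have nt31 n : e v n -> t31 n = false.
    by move=> vn'; apply/negP => nt'; move: vn'; apply/negP/t31_t31.
  by rewrite !nt31 // !andbF (negbTE v2).
have {}vt : t30 v by rewrite /t30 v3 vt.
case: (boolP (weak v)) => vw.
  have [u1 [u2 [z [u1t u2t u12 zt vn]]]] := weak_leaves vw.
  have vu1 : e v u1 by rewrite vn eqxx.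
  have vz : e v z by rewrite vn eqxx !orbT.
  have zu1 : z != u1 by apply: contraNneq zt => ->.
  have zu2 : z != u2 by apply: contraNneq zt => ->.
  (* Hence [z] pays [v] without being paid back, which balances the two leaves. *)
  have zw : ~~ weak z by apply/negP => zw; apply: (@weak_leaf v z u1).
  have vu2 : e v u2 by rewrite vn eqxx orbT.
  have gu u : e v u -> t31 u -> give v u = 1.
    by move=> vu ut; rewrite /give vu v2 (negbTE (t31_two ut)) ut.
  have z2 := t30_nbr vt vz.
  have gz : give v z = 0.
    by rewrite /give vz v2 (negbTE z2) (negbTE zt) (negbTE zw).
  have zg : give z v = 1 by rewrite /give e_sym vz z2 (negbTE v2) vw zt orbT.
  rewrite !(sum_three _ u12 zu1 zu2 vn) (gu u1) // (gu u2) // gz zg.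
  by rewrite -[20 + _]/(7 * 3 + 1) !addnA leq_add2r -addnA leq_addr.
suff: \sum_(n | e v n) give v n <= 1 by lia.
pose A := [set n | e v n & t31 n || weak n].
have -> : \sum_(n | e v n) give v n = #|A|.
  rewrite -sum1dep_card big_mkcondr; apply: eq_bigr => n vn.
  rewrite /give vn v2 (negbTE (t30_nbr vt vn)) (t30_t31 vt) andbT /= andbT.
  by case: (_ || _).
rewrite leqNgt; apply/negP => /card_gt1P[a [b []]]; rewrite !inE.
move=> /andP[va +] /andP[vb +] ab => /orP[at_|aw] /orP[bt|bw].
- case/negP: vw; rewrite /weak vt; apply/card_gt1P; exists a, b.
  by rewrite !inE va vb at_ bt ab.
- exact: (@weak_leaf v b a).
- exact: (@weak_leaf v a b).
- exact: (@weak_weak v a b).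
Qed.

Lemma total_charge : 20 * #|T| <= 7 * \sum_v deg v.
Proof.
have: \sum_v (20 + \sum_n give v n) <= \sum_v (7 * deg v + \sum_n give n v).
  by apply: leq_sum => v _; apply: discharge.
rewrite big_split [X in _ <= X]big_split [X in _ <= addn _ X]exchange_big leq_add2r.
by rewrite sum_nat_const mulnC big_distrr.
Qed.

End Configurations.

(** * Minimal counterexample *)

(** Swapping the components pairs off the ordered pairs; the ranks select one from each couple. This
    makes the halving in [n_edges_in] exact. *)
Lemma even_pairs (T : finType) (e : rel T) :
  symmetric e -> irreflexive e -> 2 %| #|[set p : T * T | e p.1 p.2]|.
Proof.
move=> e_sym e_irr; set P := [set p | _].
pose lt (p : T * T) := enum_rank p.1 < enum_rank p.2.
rewrite -(cardsID [set p | lt p] P).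
have -> : P :\: [set p | lt p] = (fun p => (p.2, p.1)) @: (P :&: [set p | lt p]).
  apply/setP => -[x y]; rewrite !inE /lt /=; apply/andP/imsetP => [[ltxy xy]|].
    exists (y, x); rewrite // !inE /= e_sym xy /=.
    move: ltxy; rewrite -leqNgt leq_eqVlt => /orP[/eqP eq_r|//].
    by move/ord_inj/enum_rank_inj: eq_r xy => ->; rewrite e_irr.
  case=> -[a b]; rewrite !inE /= => /andP[ab lt_ab] [-> ->].
  by rewrite e_sym ab -leqNgt ltnW.
by rewrite card_imset ?addnn ?dvdn2 ?odd_double // => -[a b] [c d] [-> ->].
Qed.

Lemma switch_equiv_fold (T : finType) (s : T -> T -> bool) (r : seq T) :
  switch_equiv s (foldr (@switch T) s r).
Proof.
elim: r => [|w r IH] /=; first exact: rt_refl.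
by apply: rt_trans IH _; apply: rt_step; exists w.
Qed.

(** Without repetitions no two switches of a vertex cancel. *)
Lemma foldr_switch (T : finType) (s : T -> T -> bool) (r : seq T) u v : uniq r ->
  foldr (@switch T) s r u v = s u v (+) ((u \in r) (+) (v \in r)).
Proof.
elim: r => [|w r IH]; first by rewrite !addbF.
rewrite cons_uniq => /andP[w_r /IH]; rewrite /= /switch => ->; rewrite !inE -addbA.
congr (_ (+) _).
case: (eqVneq u w) => [->|_]; case: (eqVneq v w) => [->|_];
  by rewrite /= ?(negbTE w_r) //; case: (_ \in r); rewrite ?addbF //; case: (_ \in r).
Qed.

Lemma paley_nonsquare (i j : 'I_5) : @paley_neg 'F_5 i j = nonsquare i j.
Proof.
(* The squares 0, 1, 4 have the roots 0, 1, 2. *)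
have squares (d : 'F_5) : [exists x : 'F_5, (x ^+ 2 == d)%R] = (nat_of_ord d \in [:: 0; 1; 4]).
  apply/existsP/idP => [[x /eqP <-]|].
    by case: x => [[|[|[|[|[|x]]]]] ltx].
  rewrite !inE => /or3P[] /eqP Ed; [exists 0%R | exists 1%R | exists 2%:R%R];
    by apply/eqP/val_inj; rewrite /= Ed.
rewrite /paley_neg squares.
by case: i => [[|[|[|[|[|i]]]]] lti] //; case: j => [[|[|[|[|[|j]]]]] ltj].
Qed.

(** * Colouring induced subgraphs by induction on their order *)

Section Colouring.

Variables (T : finType) (e : rel T) (s : T -> T -> bool).
Hypotheses (e_sym : symmetric e) (e_irr : irreflexive e).
Hypothesis s_sym : forall u v, e u v -> s u v = s v u.

Definition colorable (S : {set T}) := [exists f : {ffun T -> color},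
  [forall u in S, forall v in S, e u v ==> compat (s u v) (f u) (f v)]].

Lemma colorableP (S : {set T}) : reflect (exists f : T -> color,
  forall u v, u \in S -> v \in S -> e u v -> compat (s u v) (f u) (f v)) (colorable S).
Proof.
apply: (iffP existsP) => -[f].
  move=> /forallP fS; exists f => u v uS vS uv.
  by move/implyP: (fS u) => /(_ uS)/forallP/(_ v); rewrite vS uv.
move=> fS; exists (finfun f); apply/forallP => u; apply/implyP => uS.
apply/forallP => v; apply/implyP => vS; apply/implyP; rewrite !ffunE; exact: fS.
Qed.

Lemma mad_charge (S : {set T}) : mad_lt e (20%:Q / 7%:Q)%R -> S != set0 ->
  7 * #|[set p : T * T | [&& p.1 \in S, p.2 \in S & e p.1 p.2]]| < 20 * #|S|.
Proof.
move=> mad S0; have := mad S S0; rewrite /n_edges_in; set P := [set p | _].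
have /divnK even : 2 %| #|P|.
  apply: (@even_pairs T (fun x y => [&& x \in S, y \in S & e x y])).
    by move=> x y; rewrite andbCA e_sym.
  by move=> x; rewrite e_irr !andbF.
rewrite mulnC even ltr_pdivrMr ?ltr0n ?card_gt0 // mulrAC.
rewrite -[20%:~R%R]/(20%:R)%R -[7%:~R%R]/(7%:R)%R ltr_pdivlMr ?ltr0n // -!natrM ltr_nat.
by rewrite mulnC.
Qed.

(** If [S] were not colourable, the subgraph induced on it would be irreducible: a colouring of [S]
    without [X] cannot extend to [X]. Then [total_charge] contradicts [mad_charge]. *)
Lemma colorable_step (S : {set T}) : mad_lt e (20%:Q / 7%:Q)%R ->
  (forall S' : {set T}, S' \proper S -> colorable S') -> colorable S.
Proof.
move=> mad IH; case: (eqVneq S set0) => [->|S0].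
  by apply/colorableP; exists (fun=> (ord0, true)) => u v; rewrite inE.
case: (boolP (colorable S)) => // ncol; exfalso; pose U : finType := {x : T | x \in S}.
pose eU : rel U := fun x y => e (val x) (val y).
pose sU (x y : U) := s (val x) (val y).
have eU_sym : symmetric eU by move=> x y; apply: e_sym.
have eU_irr : irreflexive eU by move=> x; apply: e_irr.
have sU_sym x y : eU x y -> sU x y = sU y x by apply: s_sym.
have irr (X : {set U}) : X != set0 -> ~ (forall f, ext eU sU X set0 f).
  move=> /set0Pn[x0 x0X] eX; case/negP: ncol.
  have /IH/colorableP[f fP] : S :\: (val @: X) \proper S.
    apply/properP; split; first exact: subsetDl.
    by exists (val x0); [apply: valP | rewrite inE imset_f].
  have /extP[g [gf gX]] := eX [ffun x => f (val x)].
  have gP x y : eU x y -> compat (sU x y) (g x) (g y).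
    move=> xy; case: (boolP (x \in X)) => xX; first by apply: gX; rewrite ?inE.
    case: (boolP (y \in X)) => yX.
      by rewrite (sU_sym _ _ xy) compatC; apply: gX; rewrite ?inE // eU_sym.
    rewrite !gf // !ffunE; apply: fP => //.
      by rewrite inE (valP x) andbT (mem_imset _ _ val_inj).
    by rewrite inE (valP y) andbT (mem_imset _ _ val_inj).
  apply/colorableP.
  exists (fun u => if insub u is Some x then g x else (ord0, true)) => u v uS vS uv.
  by rewrite !insubT; apply: gP.
have := total_charge eU_sym eU_irr sU_sym irr; rewrite leqNgt => /negP; apply.
have -> : #|U| = #|S| by rewrite card_sig.
have -> : \sum_v deg eU v = #|[set p : T * T | [&& p.1 \in S, p.2 \in S & e p.1 p.2]]|.
  rewrite /deg; under eq_bigr do rewrite /nb -sum1dep_card.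
  rewrite pair_big_dep sum1dep_card /=.
  have inj2 : injective (fun p : U * U => (val p.1, val p.2)).
    by move=> [a b] [c d] [/val_inj-> /val_inj->].
  rewrite -(card_imset _ inj2); apply: eq_card => -[a b]; rewrite !inE /=.
  apply/imsetP/and3P => [[[x y]]|[aS bS ab]].
    by rewrite inE /= => xy [-> ->]; split; [exact: valP x | exact: valP y | exact: xy].
  by exists (Sub a aS, Sub b bS); rewrite ?inE.
exact: mad_charge.
Qed.

Lemma colorable_all (S : {set T}) : mad_lt e (20%:Q / 7%:Q)%R -> colorable S.
Proof.
move=> mad; elim: {S}_.+1 {-2}S (ltnSn #|S|) => // n IH S leSn.
apply: colorable_step => // S' /proper_card ltS'S; apply: IH.
exact: leq_trans ltS'S _.
Qed.

End Colouring.

Theorem theorem2 (T : finType) (e : rel T) (s : T -> T -> bool) :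
  signed_graph e s ->
  mad_lt e (20%:Q / 7%:Q)%R ->
  exists phi : T -> 'F_5,
    signed_hom e s (@paley_adj 'F_5) (@paley_neg 'F_5) phi.
Proof.
case=> e_sym [e_irr s_sym] mad.
have /colorableP[f fP] := colorable_all e_sym e_irr s_sym [set: T] mad.
(* A colour splits into the image in the Paley graph and the bit saying whether the vertex is
   switched. *)
exists (fun u => (f u).1); pose r := [seq u <- enum T | (f u).2].
exists (foldr (@switch T) s r); split=> [|u v uv]; first exact: switch_equiv_fold.
have /andP[f1 /eqP f2] := fP u v (in_setT _) (in_setT _) uv.
split; first by apply: contraNneq f1 => ->.
have mem_r w : (w \in r) = (f w).2 by rewrite mem_filter mem_enum andbT.
by rewrite paley_nonsquare -f2 foldr_switch ?mem_r // filter_uniq // enum_uniq.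
Qed.
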